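(* Let $R=k[x_1,\ldots,x_n]$ be a polynomial ring over a field $k$ and let $I\subset R$ be a zero-dimensional monomial ideal. With the notation $\mathcal F(I)$, $s$, $L_i$, $Y$, $Y_i$, $K$, $K_i$ defined in the context: (a) The minimal primes of $\mathcal F(I)$ are $L_1,\ldots,L_s$. (b) $K=\bigcap_{i=1}^s(K_i,\,Y\setminus Y_i)$ is an irredundant intersection of prime ideals.
   Context: Let $\mathfrak m=(x_1,\ldots,x_n)$. For an ideal $J$ of $R$, $\mathcal R(J)=R[Jt]\subset R[t]$ is its Rees ring and $\mathcal F(J)=\mathcal R(J)\otimes_RR/\mathfrak m=\bigoplus_{j\ge0}J^j/\mathfrak mJ^j$ its special fiber ring. Let $v_1,\ldots,v_s$ be the Rees valuations of $I$, i.e. the normalized valuations of the discrete valuation rings $\overline{\mathcal R}_{\mathfrak Q}$, where $\overline{\mathcal R}=\bigoplus_{j\ge0}\overline{I^j}t^j$ is the integral closure of $\mathcal R(I)$ and $\mathfrak Q$ ranges over the minimal primes of $I\overline{\mathcal R}$. They correspond to the non-coordinate supporting hyperplanes of the facets of the Newton polyhedron of $I$: a hyperplane $\ell_1z_1+\cdots+\ell_nz_n=M$ with nonnegative integers $\ell_j,M$ and $\gcd(\ell_1,\ldots,\ell_n,M)=1$ gives the monomial valuation with $v(x_j)=\ell_j$ and $v(I)=M$. Set $d_i=v_i(I)=\min\{v_i(f):f\in I\}$, and let $I_i$ be the monomial ideal generated by all monomials $\alpha\in I$ with $v_i(\alpha)=d_i$. Let $\mathcal G=\{\alpha_j\}$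 be the set of minimal monomial generators of $I$ and $\mathcal G_i=\{\alpha_j\in\mathcal G:v_i(\alpha_j)=d_i\}$, which is the set of minimal monomial generators of $I_i$. Let $Y=\{y_j:\alpha_j\in\mathcal G\}$ be a set of variables and $Y_i=\{y_j:\alpha_j\in\mathcal G_i\}$. Let $L_i=(\alpha_j+\mathfrak mI:\alpha_j\in\mathcal G\setminus\mathcal G_i)\,\mathcal F(I)$. Let $K$ be the kernel of the surjection $k[Y]\to\mathcal F(I)/\sqrt0$ sending $y_j$ to the class of $\alpha_j+\mathfrak mI$, and $K_i$ the kernel of the surjection $k[Y_i]\to\mathcal F(I_i)/\sqrt0$ sending $y_j$ to the class of $\alpha_j+\mathfrak mI_i$. $(K_i,Y\setminus Y_i)$ denotes the ideal of $k[Y]$ generated by $K_i$ and the variables in $Y\setminus Y_i$. *)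

(* Defs.v *)
From HB Require Import structures.
From mathcomp Require Import all_boot all_order all_algebra.
From mathcomp.classical Require Import boolp classical_sets.
From mathcomp Require Import mpoly.

Set Implicit Arguments.
Unset Strict Implicit.
Unset Printing Implicit Defensive.

Import Order.TTheory GRing.Theory Num.Theory.

Local Open Scope classical_set_scope.
Local Open Scope quotient_scope.
Local Open Scope ring_scope.

(* Ideals are plain sets rather than [idealr] predicates because the latter   *)
(* are proper by definition, while J^0 is the unit ideal.                     *)

Section Ideals.
Variable A : comNzRingType.
Implicit Types (J L P : set A).

Definition is_ideal J :=
  [/\ J 0, forall x y, J x -> J y -> J (x + y) & forall a x, J x -> J (a * x)].

Definition ideal_gen (S : set A) : set A :=
  [set x | forall J, is_ideal J -> S `<=` J -> J x].

Definition ideal_mul J L : set A :=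
  ideal_gen [set x * y | x in J & y in L].

Fixpoint ideal_exp J (j : nat) : set A :=
  if j is j'.+1 then ideal_mul J (ideal_exp J j') else setT.

Definition prime_ideal P :=
  [/\ is_ideal P, ~ P 1 & forall x y, P (x * y) -> P x \/ P y].

Definition minimal_prime_over J P :=
  [/\ prime_ideal P, J `<=` P &
      forall P', prime_ideal P' -> J `<=` P' -> P' `<=` P -> P' = P].

Definition minimal_prime P := minimal_prime_over [set 0] P.

(* dim A/J = 0, the chains of primes of A/J being those of primes of A        *)
(* containing J.                                                              *)
Definition zero_dimensional J :=
  (exists2 P, prime_ideal P & J `<=` P) /\
  forall P P', prime_ideal P -> prime_ideal P' -> J `<=` P -> P `<=` P' ->
    P = P'.

(* x^m + a_1 x^(m-1) + ... + a_m = 0 with a_i in J^i; there is no solution    *)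
(* with m = 0 since A is nonzero.                                             *)
Definition integral_closure J : set A :=
  [set x | exists m (a : nat -> A),
     (forall i, (1 <= i <= m)%N -> ideal_exp J i (a i)) /\
     x ^+ m + \sum_(1 <= i < m.+1) a i * x ^+ (m - i) = 0].

Definition nilradical : {pred A} := fun x => `[< exists m, x ^+ m = 0 >].

Lemma ideal_genP (S : set A) : is_ideal (ideal_gen S).
Proof.
split=> [J [] //|x y Sx Sy J iJ sJ|a x Sx J iJ sJ].
  by case: (iJ) => _ + _; apply; [apply: Sx | apply: Sy].
by case: (iJ) => _ _; apply; apply: Sx.
Qed.

Lemma sub_ideal_gen (S : set A) : S `<=` ideal_gen S.
Proof. by move=> x Sx J _; apply. Qed.

Lemma idealB J x y : is_ideal J -> J x -> J y -> J (x - y).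
Proof.
by move=> [_ JD JM] Jx Jy; apply: JD => //; rewrite -mulN1r; apply: JM.
Qed.

Lemma ideal_sum J I (r : seq I) (Q : pred I) (F : I -> A) : is_ideal J ->
  (forall i, Q i -> J (F i)) -> J (\sum_(i <- r | Q i) F i).
Proof. by move=> [J0 JD _] JF; elim/big_rec: _ => // i x /JF; apply: JD. Qed.

Lemma ideal_expP J j : is_ideal (ideal_exp J j).
Proof. by case: j => [|j] /=; [split | apply: ideal_genP]. Qed.

Lemma ideal_expD J i j x y :
  ideal_exp J i x -> ideal_exp J j y -> ideal_exp J (i + j) (x * y).
Proof.
move=> Jx Jy; elim: i => [|i IH] /= in x Jx *.
  by rewrite add0n; case: (ideal_expP J j) => _ _; apply.
pose J' := [set x | ideal_exp J (i.+1 + j) (x * y)].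
have [J0 JD JM] := ideal_expP J (i.+1 + j).
apply: (Jx J') => [|_ [u Ju] [w Jw] <-].
  split=> [|u w Ju Jw|a u Ju]; rewrite /J' /mkset.
  - by rewrite mul0r.
  - by rewrite mulrDl; apply: JD.
  - by rewrite -mulrA; apply: JM.
rewrite /J' /mkset addSn -mulrA; apply: sub_ideal_gen.
by exists u => //; exists (w * y) => //; apply: IH.
Qed.

Lemma ideal_expM J i j x :
  ideal_exp (ideal_exp J j) i x -> ideal_exp J (j * i) x.
Proof.
elim: i x => [|i IH] x /=; first by rewrite muln0.
move=> /(_ (ideal_exp J (j * i.+1))); apply; first exact: ideal_expP.
by move=> _ [u Ju [w Jw <-]]; rewrite mulnS; apply: ideal_expD => //; apply: IH.
Qed.

Lemma ideal_expMr J i j x :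
  ideal_exp J (i * j) x -> ideal_exp (ideal_exp J j) i x.
Proof.
elim: i x => [|i IH] x //=; rewrite mulSn.
set L := ideal_mul _ _.
have iL : is_ideal L by exact: ideal_genP.
have [L0 LD LM] := iL.
have H : forall m y, ideal_exp J (m + i * j) y ->
    forall c, (forall a, ideal_exp J m a -> ideal_exp J j (c * a)) -> L (c * y).
  elim=> [|m IHm] y /= Jy c cJ.
    apply: sub_ideal_gen; exists c; first by have := cJ 1 I; rewrite mulr1.
    by exists y => //; apply: IH.
  apply: (Jy [set y | L (c * y)]) => [|_ [u Ju [w Jw <-]]].
    split=> [|a b La Lb|a b Lb]; rewrite /mkset.
    - by rewrite mulr0.
    - by rewrite mulrDr; apply: LD.
    - by rewrite mulrCA; apply: LM.
  rewrite /mkset mulrA; apply: (IHm _ Jw) => a Ja; rewrite -mulrA.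
  by apply: cJ; apply: sub_ideal_gen; exists u => //; exists a.
by move=> Jx; rewrite -[x]mul1r; apply: (H j) => // a; rewrite mul1r.
Qed.

Lemma nilradical_idealr : idealr_closed nilradical.
Proof.
split.
- by apply/asboolP; exists 1%N; rewrite expr1.
- apply/negP => /asboolP [m]; rewrite expr1n => /eqP.
  by rewrite oner_eq0.
- move=> a u v /asboolP [p up] /asboolP [q vq]; apply/asboolP.
  exists (p + q)%N; rewrite exprDn big1 // => -[i /= _] _.
  have [qi|iq] := leqP q i.
    by rewrite -(subnK qi) exprD vq mulr0 mulr0 mul0rn.
  have pi : (p <= p + q - i)%N by rewrite -addnBA ?leq_addr // ltnW.
  by rewrite -(subnK pi) exprMn [u ^+ _]exprD up !mulr0 mul0r mul0rn.
Qed.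

HB.instance Definition _ := isIdealr.Build A nilradical nilradical_idealr.

Definition reduced := {ideal_quot nilradical}.
HB.instance Definition _ := GRing.ComNzRing.on reduced.

End Ideals.

(* R(J) = A[Jt], as the subring of the polynomials sum_j f_j t^j of A[t] with *)
(* f_j in J^j; the variable 'X of {poly A} plays the role of t.               *)

Section Rees.
Variables (A : comNzRingType) (J : set A).

Definition rees_pred : {pred {poly A}} :=
  fun f => `[< forall j, ideal_exp J j f`_j >].

Lemma rees_closed : subring_closed rees_pred.
Proof.
split.
- apply/asboolP => -[|j] //; rewrite coef1 /=.
  by case: (ideal_expP J j.+1).
- move=> f g /asboolP Hf /asboolP Hg; apply/asboolP => j; rewrite coefB.
  exact: idealB (ideal_expP J j) _ _.
- move=> f g /asboolP Hf /asboolP Hg; apply/asboolP => j; rewrite coefM.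
  apply: ideal_sum (ideal_expP J j) _ => i _.
  by rewrite -{1}(subnKC (leq_ord i)); apply: ideal_expD.
Qed.

HB.instance Definition _ := GRing.isSubringClosed.Build _ rees_pred rees_closed.

Record rees := Rees { rees_val :> {poly A}; _ : rees_val \in rees_pred }.
HB.instance Definition _ := [isSub for rees_val].
HB.instance Definition _ := [Choice of rees by <:].
HB.instance Definition _ := [SubChoice_isSubComNzRing of rees by <:].
HB.instance Definition _ :=
  GRing.RMorphism.copy rees_val (\val : rees -> {poly A}).

Lemma rees_const_subproof (a : A) : a%:P \in rees_pred.
Proof.
apply/asboolP => -[|j] //; rewrite coefC /=.
by case: (ideal_expP J j.+1).
Qed.
Definition rees_const (a : A) : rees := Rees (rees_const_subproof a).

(* sum_j closure(J^j) t^j *)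
Definition reesbar_pred : {pred {poly A}} :=
  fun f => `[< forall j, integral_closure (ideal_exp J j) f`_j >].

(* A homogeneous element f t^j is integral over R(J) iff f is integral over   *)
(* the ideal J^j, so that integrality over R(J) yields the closure of the     *)
(* above under the ring operations.                                           *)
Lemma integral_homogeneous j (f : A) :
  integral_closure (ideal_exp J j) f <->
  integralOver (\val : rees -> {poly A}) (f%:P * 'X^j).
Proof.
split=> [[m [a [Ja eqf]]]|[p mp /rootP]].
  have ra i : (1 <= i <= m)%N -> (a i)%:P * 'X^(j * i) \in rees_pred.
    move=> /Ja /ideal_expM Jai; apply/asboolP => l; rewrite coefCM coefXn.
    by case: eqP => [->|_]; rewrite ?mulr1 // mulr0; case: (ideal_expP J l).
  pose c i : rees := insubd 0 ((a i)%:P * 'X^(j * i)).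
  pose q : {poly rees} := \sum_(1 <= i < m.+1) (c i)%:P * 'X^(m - i).
  have sq : (size q < size ('X^m : {poly rees}))%N.
    rewrite size_polyXn ltnS /q big_add1 /= big_mkord.
    apply: (leq_trans (size_sum _ _ _)); apply/bigmax_leqP => i _.
    rewrite mul_polyC; apply: leq_trans (size_scale_leq _ _) _.
    by rewrite size_polyXn -subSn // subSS leq_subr.
  exists ('X^m + q).
    by rewrite monicE lead_coefDl // lead_coefXn.
  apply/rootP; rewrite rmorphD /= map_polyXn hornerD hornerXn.
  rewrite rmorph_sum /= horner_sum.
  rewrite (eq_big_nat _ _ (F2 := fun i => (a i * f ^+ (m - i))%:P * 'X^(j * m))).
    rewrite -mulr_suml -rmorph_sum /= exprMn -exprM -rmorphXn /= -mulrDl.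
    by rewrite -rmorphD /= eqf mul0r.
  move=> i /andP [i1 im]; rewrite rmorphM /= map_polyC map_polyXn /=.
  rewrite hornerM hornerC hornerXn /c insubdK ?ra ?i1 //.
  rewrite exprMn -exprM mulrACA -exprD -mulnDr subnKC //.
  by rewrite -rmorphXn /= -rmorphM.
have [m sp] : {m | size p = m.+1}.
  by exists (size p).-1; rewrite prednK // lt0n size_poly_eq0 monic_neq0.
rewrite (horner_coef_wide _ (n := m.+1)); last by rewrite -sp size_poly.
move=> /(congr1 (fun h : {poly A} => h`_(j * m))); rewrite coef0 coef_sum.
pose a i := (val (p`_(m - i)))`_(j * i).
move=> eqf; exists m, a; split=> [i im|].
  apply: ideal_expMr; rewrite mulnC.
  by rewrite /a; case: (p`_(m - i)) => h /= /asboolP.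
apply: etrans eqf; rewrite big_ord_recr /= addrC; congr (_ + _).
  rewrite coef_map_id0 ?raddf0 //.
  have -> : p`_m = 1 by move/monicP: mp; rewrite lead_coefE sp.
  by rewrite rmorph1 mul1r exprMn -exprM -rmorphXn /= coefCM coefXn eqxx mulr1.
rewrite big_add1 /= big_mkord [RHS](reindex_inj rev_ord_inj) /=.
apply: eq_bigr => i _; rewrite coef_map_id0 ?raddf0 //.
rewrite exprMn -exprM -rmorphXn /= mulrCA coefCM coefMXn mulrC /a.
by rewrite ltnNge leq_mul2l leq_subr orbT /= -mulnBr subKn.
Qed.

Lemma reesbar_closed : subring_closed reesbar_pred.
Proof.
have intP f j : f \in reesbar_pred ->
    integralOver (\val : rees -> {poly A}) ((f`_j)%:P * 'X^j).
  by move=> /asboolP /(_ j) /integral_homogeneous.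
split.
- apply/asboolP => j; apply/integral_homogeneous; rewrite coef1.
  case: j => [|j]; first by rewrite expr0 mulr1; apply: integral1.
  by rewrite mul0r; apply: integral0.
- move=> f g Hf Hg; apply/asboolP => j; apply/integral_homogeneous.
  rewrite coefB rmorphB /= mulrBl; apply: integral_sub; exact: intP.
- move=> f g Hf Hg; apply/asboolP => j; apply/integral_homogeneous.
  rewrite coefM rmorph_sum /= mulr_suml.
  elim/big_rec: _ => [|i x _ Hx]; first exact: integral0.
  apply: integral_add => //.
  rewrite (_ : 'X^j = 'X^i * 'X^(j - i)); last by rewrite -exprD subnKC ?leq_ord.
  rewrite rmorphM /= mulrACA.
  by apply: integral_mul; apply: intP.
Qed.

HB.instance Definition _ :=
  GRing.isSubringClosed.Build _ reesbar_pred reesbar_closed.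

Record reesbar :=
  Reesbar { reesbar_val :> {poly A}; _ : reesbar_val \in reesbar_pred }.
HB.instance Definition _ := [isSub for reesbar_val].
HB.instance Definition _ := [Choice of reesbar by <:].
HB.instance Definition _ := [SubChoice_isSubComNzRing of reesbar by <:].
HB.instance Definition _ :=
  GRing.RMorphism.copy reesbar_val (\val : reesbar -> {poly A}).

Lemma reesbar_const_subproof (a : A) : a%:P \in reesbar_pred.
Proof.
apply/asboolP => j; apply/integral_homogeneous; rewrite coefC.
case: eqP => [->|_]; last by rewrite mul0r; apply: integral0.
by rewrite expr0 mulr1; apply: (integral_id _ (rees_const a)).
Qed.
Definition reesbar_const (a : A) : reesbar := Reesbar (reesbar_const_subproof a).

End Rees.

(* Valuations are Z-valued functions on a field of which only the values at   *)
(* nonzero elements are meaningful.                                           *)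

Definition normalized_valuation (K : fieldType) (w : K -> int) :=
  [/\ forall x y, x != 0 -> y != 0 -> w (x * y) = w x + w y,
      forall x y, x != 0 -> y != 0 -> x + y != 0 ->
        Num.min (w x) (w y) <= w (x + y) &
      exists2 x, x != 0 & w x = 1].

Definition valuation_ring (K : fieldType) (w : K -> int) : set K :=
  [set x | x = 0 \/ 0 <= w x].

Section ReesValuations.
Variables (A : idomainType) (J : set A).

Definition reesbar_loc (Q : set (reesbar J)) : set {fraction {poly A}} :=
  [set z | exists a b : reesbar J,
     ~ Q b /\ z = tofrac (a : {poly A}) / tofrac (b : {poly A})].

Definition reesbar_ext : set (reesbar J) :=
  ideal_gen (reesbar_const J @` J).

(* v lists, without repetition, the normalized valuations of the localizations *)
(* of the normalized Rees ring at the minimal primes of the extension of J.   *)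
Definition rees_valuations (s : nat) (v : 'I_s -> {fraction {poly A}} -> int) :=
  exists Q : 'I_s -> set (reesbar J),
    [/\ injective Q,
        forall P, minimal_prime_over reesbar_ext P <-> exists i, Q i = P &
        forall i, normalized_valuation (v i) /\
                  valuation_ring (v i) = reesbar_loc (Q i)].

Definition val_of (w : {fraction {poly A}} -> int) (f : A) : int := w (tofrac f%:P).

(* w(J) = min {w(f) : f in J}, with the default value 0 if there is no minimum *)
Definition ideal_value (w : {fraction {poly A}} -> int) : int :=
  xget 0 [set d | (exists f, [/\ J f, f != 0 & val_of w f = d]) /\
                  forall f, J f -> f != 0 -> d <= val_of w f].

End ReesValuations.

Section Fiber.
Variables (k : fieldType) (n : nat).
Local Notation R := {mpoly k[n]}.
Implicit Types (I : set R) (a b : 'X_{1..n}).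

Definition monomial_ideal I :=
  exists S : set 'X_{1..n}, I = ideal_gen [set 'X_[a] | a in S].

Definition mingen I a :=
  I 'X_[a] /\ forall b, I 'X_[b] -> (b <= a)%MM -> b = a.

Definition maxideal : set R := ideal_gen (range (fun i : 'I_n => 'X_i)).

Definition fiber_ideal I : {pred rees I} :=
  fun f => `[< ideal_gen (rees_const I @` maxideal) f >].

Lemma fiber_ideal_idealr I : idealr_closed (@fiber_ideal I).
Proof.
have [J0 JD JM] := ideal_genP (rees_const I @` maxideal).
split.
- exact/asboolP.
- apply/asboolP => /(_ [set f : rees I | ((f : {poly R})`_0).@[fun=> 0] = 0]) H.
  have /eqP : ((1 : {poly R})`_0).@[fun=> 0 : k] = 0; last first.
    by rewrite coef1 /= rmorph1 oner_eq0.
  apply: H.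
    split=> [|x y Hx Hy|x y Hy]; rewrite /mkset /=.
    + by rewrite coef0 raddf0.
    + by rewrite coefD raddfD /= Hx Hy addr0.
    + by rewrite coefM big_ord_recl big_ord0 addr0 rmorphM /= Hy mulr0.
  move=> _ [x mx <-]; rewrite /mkset /= coefC /=.
  apply: (mx [set x : R | x.@[fun=> 0] = 0]).
    split=> [|u w Hu Hw|u w Hw]; rewrite /mkset.
    + by rewrite raddf0.
    + by rewrite raddfD /= Hu Hw addr0.
    + by rewrite rmorphM /= Hw mulr0.
  by move=> _ [i _ <-]; rewrite /mkset mevalXU.
- move=> c u w /asboolP Hu /asboolP Hw; apply/asboolP.
  by apply: JD => //; apply: JM.
Qed.

HB.instance Definition _ I :=
  isIdealr.Build (rees I) (@fiber_ideal I) (@fiber_ideal_idealr I).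

(* F(I) = R(I)/mR(I) *)
Definition fiber I := {ideal_quot @fiber_ideal I}.
HB.instance Definition _ I := GRing.ComNzRing.on (fiber I).

(* The element x^a t of R(I), for x^a in I; the default value 0 is never used *)
(* in this case.                                                              *)
Definition rees_mon I a : rees I := insubd 0 ('X_[a]%:P * 'X).

(* The class of x^a + mI, in degree 1 of F(I). *)
Definition fiber_mon I a : fiber I := \pi_(fiber I) (rees_mon I a).

(* k[y_1, ..., y_m] -> F(I)/sqrt(0), y_j |-> class of x^(alpha_j) + mI *)
Definition fiber_map I m (alpha : 'I_m -> 'X_{1..n}) (p : {mpoly k[m]}) :
    reduced (fiber I) :=
  \pi_(reduced (fiber I)) (\pi_(fiber I)
    (mmap (fun c => rees_const I c%:MP) (fun j => rees_mon I (alpha j)) p)).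

Definition fiber_ker I m (alpha : 'I_m -> 'X_{1..n}) : set {mpoly k[m]} :=
  [set p | fiber_map I alpha p = 0].

Variables (I : set R) (r : nat) (alpha : 'I_r -> 'X_{1..n}).
Variable w : {fraction {poly R}} -> int.

Definition face_ideal : set R :=
  ideal_gen [set 'X_[a] | a in
    [set a | I 'X_[a] /\ val_of w 'X_[a] = ideal_value I w]].

Definition face_vars : {set 'I_r} :=
  [set j | val_of w 'X_[alpha j] == ideal_value I w]%SET.

Definition fiber_prime : set (fiber I) :=
  ideal_gen [set fiber_mon I (alpha j) | j in [set j | j \notin face_vars]].

(* k[Y_i] is {mpoly k[#|Y_i|]}, the variables being numbered by enum_val. *)
Definition face_emb (p : {mpoly k[#|face_vars|]}) : {mpoly k[r]} :=
  p \mPo [tuple 'X_(enum_val j) | j < #|face_vars|].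

Definition face_ker : set {mpoly k[#|face_vars|]} :=
  fiber_ker face_ideal (fun j => alpha (enum_val j)).

(* (K_i, Y \ Y_i) *)
Definition face_ker_ext : set {mpoly k[r]} :=
  ideal_gen (face_emb @` face_ker `|`
             [set 'X_j | j in [set j | j \notin face_vars]]).

End Fiber.

Arguments fiber_prime [k n] I [r] alpha w _.

(* Main.v *)
Require Import Defs.
From HB Require Import structures.
From mathcomp Require Import all_boot all_order all_algebra.
From mathcomp.classical Require Import boolp classical_sets.
From mathcomp Require Import mpoly.
From mathcomp Require Import ring zify.
Import Order.TTheory GRing.Theory Num.Theory.
Local Open Scope classical_set_scope.
Local Open Scope ring_scope.

Set Implicit Arguments.
Unset Strict Implicit.
Unset Printing Implicit Defensive.

(** Let Rbar be the integral closure of the Rees ring R(I). A weight vector l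
    with least value d on I gives the half-space d j <= l.a of exponents (a, j)
    of terms x^a t^j. All elements of R(I), and also of Rbar (wge_integral), have
    their terms in this half-space. Keeping only the terms on the boundary
    hyperplane is then a ring morphism to the domain R[t], so its kernel, the
    center of the monomial valuation defined by l, is prime (face_part_prime).

    A Rees valuation v is of this kind. Some power of each x_i lies in I, so the
    weights l_i = v(x_i) are positive, the center of the monomial valuation with
    these weights is a prime containing I, and it is contained in the prime Q of
    v because v of a sum is at least the minimum over its terms. As Q is minimal
    over I Rbar, the two coincide (rees_valuation_monomial). The facets are thus
    encoded by weights l_i, and p_i denotes the prime of R(I) formed by the
    elements without terms on the hyperplane of l_i.

    The statement rests on three facts about the p_i.
    - An element in all p_i is nilpotent modulo m R(I) (fiber_nilpotent). By
      minimal_prime_avoiding, a power of it lies in I Rbar, so its coefficients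
      are integral over a higher power of I than their degree in t indicates.
    - No face is contained in another one. If the face of l_2 is contained in the
      face of l_1, then M l_2 - l_1 is for large M again a weight vector whose
      least value on I is attained on the face of l_2, and this forces
      the center of l_1 to be contained in that of l_2 (center_sub).
    - Modulo the variables off the face i, a polynomial in Y can be replaced by a
      polynomial in Y_i, whose image in R[t] lies on the hyperplane of l_i, so
      that it is in p_i only if it is zero. This identifies the preimage of p_i
      in k[Y] with (K_i, Y minus Y_i) and the image of p_i in F(I) with L_i
      (face_ker_extP, fiber_primeP).

    By the first fact a prime of F(I) contains a product of generators, one from
    each L_i, hence contains some L_i; and the kernel K, which is the preimage
    of the radical of m R(I), is the intersection of the preimages of the p_i.
    The second fact gives the minimality of the L_i, their distinctness and the
    irredundancy of the intersection. *)

(** * Minimal primes *)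

Section MinimalPrimes.
Variable A : comNzRingType.
Implicit Types J P M : set A.

Lemma prime_expr P x m : prime_ideal P -> P (x ^+ m) -> P x.
Proof.
move=> [_ P1 Pp]; elim: m => [/P1 //|m IH]; rewrite exprS => /Pp [] //.
Qed.

Lemma prime_prod P (T : Type) (r : seq T) (F : T -> A) :
  prime_ideal P -> (forall i, ~ P (F i)) -> ~ P (\prod_(i <- r) F i).
Proof.
move=> [_ P1 Pp] PF; elim/big_rec: _ => // i x _ nPx /Pp [] //.
exact: PF.
Qed.

Lemma prime_preimage (B : comNzRingType) (f : {rmorphism A -> B}) (P : set B) :
  prime_ideal P -> prime_ideal (f @^-1` P).
Proof.
move=> [[P0 PD PM] P1 Pp]; split; first split.
- by rewrite /preimage /= rmorph0.
- by move=> x y Px Py; rewrite /preimage /= rmorphD; apply: PD.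
- by move=> a x Px; rewrite /preimage /= rmorphM; apply: PM.
- by rewrite /preimage /= rmorph1.
- by move=> x y; rewrite /preimage /= rmorphM => /Pp.
Qed.

Lemma zero_ideal_prime (B : idomainType) : prime_ideal [set 0 : B].
Proof.
split; first split=> //.
- by move=> x y -> ->; rewrite /mkset addr0.
- by move=> a x ->; rewrite /mkset mulr0.
- by move/eqP; rewrite oner_eq0.
- by move=> x y /= /eqP; rewrite mulf_eq0 => /orP [] /eqP; [left | right].
Qed.

(** The complement of a minimal prime is a maximal multiplicative set avoiding
    J, so one application of the maximality principle gives both the prime and
    its minimality. *)
Lemma minimal_prime_avoiding J g :
  is_ideal J -> (forall N, ~ J (g ^+ N)) ->
  exists2 P, minimal_prime_over J P & ~ P g.
Proof.
move=> [J0 JD JM] gJ.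
pose good M := [/\ forall N, M (g ^+ N), forall x y, M x -> M y -> M (x * y) &
                   forall x, M x -> ~ J x].
have [] := @Zorn_bigcup _ [set M | M = set0 \/ good M].
  move=> F Fgood Ftot.
  have [[M0 FM0 gM0]|noM] := pselect (exists2 M, F M & good M); last first.
    left; apply/seteqP; split=> // x [M FM Mx].
    by case: (Fgood _ FM) => [M0|gM]; [rewrite M0 in Mx | case: noM; exists M].
  have gF M x : F M -> M x -> good M.
    by move=> /Fgood [->|].
  right; split.
  - by move=> N; exists M0 => //; case: gM0.
  - move=> x y [M FM Mx] [M' FM' My].
    case: (Ftot _ _ FM FM') => MM; [exists M' | exists M] => //.
      by have [_ + _] := gF _ _ FM' My; apply=> //; apply: MM.
    by have [_ + _] := gF _ _ FM Mx; apply=> //; apply: MM.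
  - by move=> x [M FM Mx]; have [_ _] := gF _ _ FM Mx; apply.
have goodpow : good (range (fun N => g ^+ N)).
  split=> [N|_ _ [N _ <-] [N' _ <-]|_ [N _ <-]]; first by exists N.
    by exists (N + N')%N => //; rewrite exprD.
  exact: gJ.
move=> M [[M0|[Mg Mmul MJ]] Mmax].
  case: (Mmax _ _ (or_intror goodpow)); rewrite M0; split=> // /(_ 1).
  by apply; exists 0%N; rewrite ?expr0.
have M1 : M 1 by have := Mg 0%N; rewrite expr0.
have MX x m : M x -> M (x ^+ m).
  by move=> Mx; elim: m => [|m IH]; rewrite ?expr0 // exprS; apply: Mmul.
(* enlarging M by an element x outside of it must produce an element of J *)
have Mext x : ~ M x -> exists m y, M y /\ J (x ^+ m * y).
  move=> nMx; apply: contrapT => noJ.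
  apply: (Mmax [set x ^+ m * y | m in setT & y in M]).
    split=> [y My|sub]; first by exists 0%N => //; exists y => //; rewrite expr0 mul1r.
    by apply: nMx; apply: sub; exists 1%N => //; exists 1 => //; rewrite mulr1.
  right; split.
  - by move=> N; exists 0%N => //; exists (g ^+ N) => //; rewrite expr0 mul1r.
  - move=> _ _ [m _ [y My <-]] [m' _ [y' My' <-]].
    exists (m + m')%N => //; exists (y * y'); first exact: Mmul.
    by rewrite exprD mulrACA.
  - by move=> _ [m _ [y My <-]] Jxy; apply: noJ; exists m, y.
exists (~` M); last by move=> nMg; apply: nMg; have := Mg 1%N; rewrite expr1.
split.
- split; first split.
  + by move=> /MJ; apply.
  + move=> x y /Mext [m [u [Mu Jx]]] /Mext [m' [u' [Mu' Jy]]] Mxy.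
    apply: (MJ ((x + y) ^+ (m + m') * (u * u'))).
      by apply: (Mmul); [apply: MX | apply: Mmul].
    have iJ : is_ideal J by [].
    rewrite exprDn mulr_suml; apply: ideal_sum => // -[i /= _] _.
    rewrite -mulr_natl -!mulrA; apply: (JM).
    have [le|lt] := leqP m' i.
      rewrite -(subnK le) exprD.
      have -> : forall a b c d : A, a * (b * c * (u * d)) = (a * b * u) * (c * d).
        by move=> *; ring.
      exact: (JM).
    have le : (m <= m + m' - i)%N by lia.
    rewrite -(subnK le) exprD.
    have -> : forall a b c : A, a * b * (c * (u * u')) = (a * c * u') * (b * u).
      by move=> *; ring.
    exact: (JM).
  + move=> a x /Mext [m [y [My Jx]]] Max.
    apply: (MJ ((a * x) ^+ m * y)); first by apply: Mmul => //; apply: MX.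
    by rewrite exprMn -mulrA; apply: JM.
  + by apply.
  + move=> x y nMxy; apply: contrapT => /not_orP [/contrapT Mx /contrapT My].
    by apply: nMxy; apply: Mmul.
- by move=> x Jx /MJ; apply.
- move=> P [iP P1 Pp] JP PM; apply/seteqP; split=> // x nMx.
  have [m [y [My /JP Jx]]] := Mext x nMx.
  have nPy : ~ P y by move=> /PM /(_ My).
  by case: (Pp _ _ Jx) => // /(prime_expr (And3 iP P1 Pp)).
Qed.

End MinimalPrimes.

(** * Weight functions and initial forms *)

Section Weights.
Variables (k : fieldType) (n : nat) (w : measure n).
Local Notation R := {mpoly k[n]}.
Implicit Types (f g : R) (F G : {poly R}).

Definition wge e f := forall m, m \in msupp f -> (e <= w m)%N.

Lemma wge0 e : wge e 0.
Proof. by move=> m; rewrite msupp0. Qed.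

Lemma wgeD e f g : wge e f -> wge e g -> wge e (f + g).
Proof.
by move=> ef eg m /msuppD_le; rewrite mem_cat => /orP [/ef|/eg].
Qed.

Lemma wgeM e e' f g : wge e f -> wge e' g -> wge (e + e') (f * g).
Proof.
move=> ef eg m /msuppM_le/allpairsP [[m1 m2] /= [/ef le1 /eg le2 ->]].
by rewrite mfD leq_add.
Qed.

Lemma wge_exp e f m : wge e f -> wge (e * m) (f ^+ m).
Proof.
move=> ef; elim: m => [|m IH]; first by move=> a _; rewrite muln0.
by rewrite exprS mulnS; apply: wgeM.
Qed.

Lemma wge_ideal e : is_ideal (wge e).
Proof.
split; [exact: wge0 | exact: wgeD |].
move=> a f ef; rewrite -[e]add0n; exact: wgeM.
Qed.

Lemma mcoeff_pihomog e f m :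
  (pihomog w e f)@_m = if w m == e then f@_m else 0.
Proof.
rewrite pihomogE raddf_sum /=; under eq_bigr do rewrite mcoeffZ mcoeffX.
have [mf|mf] := boolP (m \in msupp f); last first.
  rewrite (memN_msupp_eq0 mf) if_same big_seq_cond big1 // => a /andP [af _].
  by case: eqP => [am|_]; rewrite ?mulr0 //; rewrite -am af in mf.
rewrite big_mkcond (bigD1_seq m) ?msupp_uniq //= eqxx mulr1 big1 ?addr0 //.
by move=> a /negPf ->; rewrite mulr0 if_same.
Qed.

Lemma pihomog_lt e d f : wge e f -> (d < e)%N -> pihomog w d f = 0.
Proof.
move=> ef de; apply/mpolyP => m; rewrite mcoeff_pihomog mcoeff0.
case: eqP => // wm; apply: contraTeq de; rewrite -mcoeff_msupp => /ef.
by rewrite wm -leqNgt.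
Qed.

Lemma pihomog_eq0 e f : wge e f -> pihomog w e f = 0 <-> wge e.+1 f.
Proof.
move=> ef; split=> [f0 m mf|/pihomog_lt]; last exact.
rewrite ltn_neqAle ef // andbT; apply/eqP => em.
move/mpolyP/(_ m): f0; rewrite mcoeff_pihomog -em eqxx mcoeff0.
by move/eqP; rewrite mcoeff_eq0 mf.
Qed.

(** The terms above the lowest weight only contribute to higher weights. *)
Lemma pihomogM e e' f g : wge e f -> wge e' g ->
  pihomog w (e + e') (f * g) = pihomog w e f * pihomog w e' g.
Proof.
move=> ef eg; have ft := pihomogP w e f; have gt := pihomogP w e' g.
have split_low d h : wge d h -> wge d.+1 (h - pihomog w d h).
  move=> dh; apply/pihomog_eq0; last by rewrite pihomogB pihomog_id subrr.
  move=> m; rewrite mcoeff_msupp mcoeffB mcoeff_pihomog.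
  case: ifP => [_|_]; first by rewrite subrr eqxx.
  by rewrite subr0 -mcoeff_msupp; apply: dh.
have low d h : wge d (pihomog w d h).
  by move=> m /(dhomog_mf (pihomogP w d h)) ->.
have -> : f * g = pihomog w e f * pihomog w e' g
    + ((f - pihomog w e f) * g + pihomog w e f * (g - pihomog w e' g)).
  by ring.
rewrite 2!pihomogD [X in X + _]pihomog_dE; last exact: dhomogM.
rewrite [X in _ + (X + _)](@pihomog_lt (e.+1 + e')) //; last first.
  by apply: wgeM => //; apply: split_low.
rewrite [X in _ + (_ + X)](@pihomog_lt (e + e'.+1)) ?addnS //; last first.
  by rewrite -addnS; apply: wgeM => //; apply: split_low.
by rewrite !addr0.
Qed.

Lemma pihomogX_wge e f m :
  wge e f -> pihomog w (e * m) (f ^+ m) = pihomog w e f ^+ m.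
Proof.
move=> ef; elim: m => [|m IH]; last first.
  by rewrite !exprS mulnS pihomogM ?IH //; apply: wge_exp.
by rewrite muln0 !expr0 pihomog_dE // dhomog1.
Qed.

(** Over a domain the initial form of a power is the power of the initial form,
    so an element of too low a weight cannot satisfy an equation of integral
    dependence: all other terms of the equation have higher weight. *)
Lemma wge_integral (J : set R) d f :
  (forall i g, ideal_exp J i g -> wge (d * i) g) ->
  integral_closure J f -> wge d f.
Proof.
move=> Jd [m [a [Ja eqf]]] m0 m0f; rewrite leqNgt; apply/negP => m0d.
have [|e] := @ex_minnP (fun e => has (fun m => w m == e) (msupp f)).
  by exists (w m0); apply/hasP; exists m0.
move=> /hasP [m1 m1f /eqP m1e] emin.
have ef : wge e f by move=> m2 m2f; apply: emin; apply/hasP; exists m2.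
have ed : (e < d)%N by rewrite -m1e (leq_ltn_trans _ m0d) // m1e ef.
have inf0 : pihomog w e f != 0.
  apply/eqP => /mpolyP/(_ m1); rewrite mcoeff_pihomog m1e eqxx mcoeff0.
  by move/eqP; rewrite mcoeff_eq0 m1f.
move/(congr1 (pihomog w (e * m))): eqf; rewrite pihomogD pihomog0.
rewrite raddf_sum /= big_nat_cond big1 ?addr0 => [|i]; last first.
  rewrite andbT => im; apply: (@pihomog_lt (d * i + e * (m - i))).
    by apply: wgeM; [apply/Jd/Ja; lia | apply: wge_exp].
  nia.
by rewrite pihomogX_wge // => /eqP; rewrite expf_eq0 (negPf inf0) andbF.
Qed.

Lemma wge_ideal_exp (J : set R) d i f :
  J `<=` wge d -> ideal_exp J i f -> wge (d * i) f.
Proof.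
move=> Jd; elim: i f => [f _ m _|i IH f /=]; first by rewrite muln0.
apply; first exact: wge_ideal.
by move=> _ [u /Jd du [v /IH dv <-]]; rewrite mulnS; apply: wgeM.
Qed.

(** When d is the least weight of an element of I, the exponents (a, j) with
    w a = d j form the cone over the face of the Newton polyhedron of I on which
    w is minimal. *)
Definition halfspace d F := forall j, wge (d * j) F`_j.

Definition face_part d F : {poly R} := \poly_(j < size F) pihomog w (d * j) F`_j.

Lemma coef_face_part d F j : (face_part d F)`_j = pihomog w (d * j) F`_j.
Proof.
by rewrite coef_poly; case: ltnP => // /leq_sizeP -> //; rewrite pihomog0.
Qed.

Lemma face_part0 d : face_part d 0 = 0.
Proof. by apply/polyP => j; rewrite coef_face_part !coef0 pihomog0. Qed.

Lemma face_part1 d : face_part d 1 = 1.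
Proof.
apply/polyP => -[|j]; rewrite coef_face_part !coef1 /= ?pihomog0 //.
by rewrite muln0 pihomog_dE // dhomog1.
Qed.

Lemma face_partD d F G : face_part d (F + G) = face_part d F + face_part d G.
Proof. by apply/polyP => j; rewrite coefD !coef_face_part coefD pihomogD. Qed.

Lemma face_partM d F G : halfspace d F -> halfspace d G ->
  face_part d (F * G) = face_part d F * face_part d G.
Proof.
move=> dF dG; apply/polyP => j; rewrite coef_face_part !coefM raddf_sum /=.
apply: eq_bigr => i _; rewrite !coef_face_part -pihomogM //.
by rewrite -mulnDr subnKC // -ltnS.
Qed.

Lemma face_part_eq0 d F : halfspace d F ->
  face_part d F = 0 <-> forall j, wge (d * j).+1 F`_j.
Proof.
move=> dF; split=> [F0 j|F0].
  by apply/pihomog_eq0 => //; rewrite -coef_face_part F0 coef0.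
by apply/polyP => j; rewrite coef_face_part coef0; apply/pihomog_eq0.
Qed.

(** On the half-space, taking the part on the boundary hyperplane is a ring
    morphism into a domain; its kernel is the center of the monomial
    valuation. *)
Lemma face_part_prime d (T : comNzRingType) (h : {rmorphism T -> {poly R}}) :
  (forall x, halfspace d (h x)) -> prime_ideal [set x | face_part d (h x) = 0].
Proof.
move=> dh; split; first split.
- by rewrite /mkset rmorph0 face_part0.
- by move=> x y; rewrite /mkset rmorphD face_partD => -> ->; rewrite addr0.
- by move=> a x; rewrite /mkset rmorphM face_partM // => ->; rewrite mulr0.
- by rewrite /mkset rmorph1 face_part1; apply/eqP/oner_neq0.
- move=> x y; rewrite /mkset rmorphM face_partM // => /eqP.
  by rewrite mulf_eq0 => /orP [] /eqP; [left | right].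
Qed.

Section Rees.
Variables (I : set R) (d : nat).
Hypothesis Id : I `<=` wge d.

Lemma rees_halfspace (F : rees I) : halfspace d F.
Proof. by case: F => F /= /asboolP IF j; apply: (wge_ideal_exp Id). Qed.

Lemma reesbar_halfspace (F : reesbar I) : halfspace d F.
Proof.
case: F => F /= /asboolP IF j; apply: wge_integral (IF j) => i f.
by move=> /ideal_expM /(wge_ideal_exp Id); rewrite mulnA.
Qed.

Lemma rees_center_prime : prime_ideal [set F : rees I | face_part d F = 0].
Proof. exact: face_part_prime rees_halfspace. Qed.

Lemma reesbar_center_prime : prime_ideal [set F : reesbar I | face_part d F = 0].
Proof. exact: face_part_prime reesbar_halfspace. Qed.

End Rees.

End Weights.

Definition wt n (l : 'I_n -> nat) (m : 'X_{1..n}) := (\sum_i m i * l i)%N.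

Lemma wt0 n (l : 'I_n -> nat) : wt l 0%MM = 0%N.
Proof. by apply: big1 => i _; rewrite mnm0E. Qed.

Lemma wtD n (l : 'I_n -> nat) :
  {morph wt l : m1 m2 / (m1 + m2)%MM >-> (m1 + m2)%N}.
Proof.
by move=> a b; rewrite -big_split; apply: eq_bigr => i _; rewrite mnmDE mulnDl.
Qed.

Lemma wt_gt0 n (l : 'I_n -> nat) m :
  (forall i, (0 < l i)%N) -> m != 0%MM -> (0 < wt l m)%N.
Proof.
move=> l0; apply: contraNT; rewrite -leqNgt leqn0 sum_nat_eq0 => /forallP m0.
apply/eqP/mnmP => i; rewrite mnm0E; have := m0 i.
by rewrite muln_eq0 => /orP [/eqP //|]; have := l0 i; case: (l i).
Qed.

HB.instance Definition _ n (l : 'I_n -> nat) :=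
  isMeasure.Build n (wt l) (wt0 l) (wtD l).

(** * Monomial ideals *)

Section MonomialIdeals.
Variables (k : fieldType) (n : nat).
Local Notation R := {mpoly k[n]}.
Implicit Types (I J : set R) (a b m : 'X_{1..n}).

Lemma ideal_mpolyX_le J a b :
  is_ideal J -> J 'X_[a] -> (a <= b)%MM -> J 'X_[b].
Proof. by move=> [_ _ JM] Ja /submK <-; rewrite mpolyXD; apply: JM. Qed.

Lemma ideal_from_supp J f :
  is_ideal J -> (forall m, m \in msupp f -> J 'X_[m]) -> J f.
Proof.
move=> iJ Jf; rewrite [f]mpolyE big_seq; apply: ideal_sum => // m mf.
by rewrite -mul_mpolyC; case: iJ => _ _; apply; apply: Jf.
Qed.

Lemma monomial_ideal_is_ideal I : monomial_ideal I -> is_ideal I.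
Proof. by move=> [S ->]; apply: ideal_genP. Qed.

Lemma monomial_ideal_supp I f m :
  monomial_ideal I -> I f -> m \in msupp f -> I 'X_[m].
Proof.
move=> [S ->] If mf.
suff [a Sa am] : exists2 a, S a & (a <= m)%MM.
  apply: ideal_mpolyX_le am; first exact: ideal_genP.
  by apply: sub_ideal_gen; exists a.
apply: (If [set f | forall m, m \in msupp f -> exists2 a, S a & (a <= m)%MM]) mf.
- split=> [? | u v Ju Jv ? | u v Jv ?]; first by rewrite msupp0.
  + by move/msuppD_le; rewrite mem_cat => /orP [/Ju|/Jv].
  + move=> /msuppM_le/allpairsP [[m1 m2] /= [_ /Jv [a Sa am] ->]].
    by exists a => //; apply: lepm_trans am (lem_addl _ _).
- by move=> _ [a Sa <-] m1; rewrite msuppX inE => /eqP ->; exists a => //; apply: lepm_refl.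
Qed.

Lemma mingen_le I a : I 'X_[a] -> exists2 b, mingen I b & (b <= a)%MM.
Proof.
have [d] := ubnP (mdeg a); elim: d => // d IH in a * => /ltnSE ad Ia.
have [|min] := pselect (exists2 b, I 'X_[b] & ((b <= a)%MM && (b != a))).
  move=> [b Ib /andP [ba nba]]; have [|//|c gc cb] := IH b.
    apply: leq_trans ad; rewrite -(submK ba) mdegD -[ltnLHS]add0n ltn_add2r.
    rewrite lt0n mdeg_eq0; apply: contraNN nba => /eqP e.
    by apply/eqP; rewrite -[RHS](submK ba) e add0m.
  by exists c => //; apply: lepm_trans ba.
exists a; last exact: lepm_refl.
split=> // b Ib ba; apply: contrapT => /eqP nba.
by apply: min; exists b; rewrite ?ba.
Qed.

Lemma monomial_ideal_mingen I J : monomial_ideal I -> is_ideal J ->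
  (forall a, mingen I a -> J 'X_[a]) -> I `<=` J.
Proof.
move=> mI iJ Jgen f If; apply: ideal_from_supp => // m mf.
have [b /Jgen Jb] := mingen_le (monomial_ideal_supp mI If mf).
exact: ideal_mpolyX_le.
Qed.

Lemma maxidealE : @maxideal k n = [set f | f@_0%MM = 0].
Proof.
have iM := ideal_genP (range (fun i : 'I_n => 'X_i : R)).
apply/seteqP; split=> [f|f f0].
  move=> Mf; apply: Mf; last by move=> _ [i _ <-]; rewrite /mkset mcoeffX mnm1_eq0.
  split=> [|x y x0 y0|a x x0]; rewrite /mkset ?mcoeff0 //.
    by rewrite mcoeffD x0 y0 addr0.
  by rewrite rmorphM /= x0 mulr0.
apply: ideal_from_supp => // m mf.
have /existsP [i mi] : [exists i, m i != 0%N].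
  rewrite -negb_forall; apply: contraTN mf => /forallP m0.
  rewrite mcoeff_msupp; apply/negPn/eqP; rewrite -[RHS]f0; congr (_@__).
  by apply/mnmP => i; rewrite mnm0E; apply/eqP.
apply: (@ideal_mpolyX_le _ U_(i)%MM) => //; last by rewrite lep1mP.
by apply: sub_ideal_gen; exists i.
Qed.

Lemma monomial_ideal_sub_max I : monomial_ideal I -> ~ I 1 -> I `<=` @maxideal k n.
Proof.
move=> mI I1 f If; rewrite maxidealE /mkset; apply/eqP.
rewrite mcoeff_eq0; apply: contra_notN I1 => /(monomial_ideal_supp mI If).
by rewrite mpolyX0.
Qed.

Lemma zero_dimensional_proper I : zero_dimensional I -> ~ I 1.
Proof. by move=> [[P [_ P1 _] IP] _] /IP. Qed.

(** If no power of x_j were in the monomial ideal I, then I would be contained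
    in the prime generated by the other variables, which is strictly smaller
    than the maximal ideal of the origin. *)
Lemma zero_dimensional_power I j : monomial_ideal I -> zero_dimensional I ->
  exists N, I ('X_j ^+ N).
Proof.
move=> mI [_ dim0]; apply: contrapT => noN.
pose h : {rmorphism R -> {poly k}} :=
  mmap (@polyC k) (fun l => if l == j then 'X else 0).
have hX m : h 'X_[m] = \prod_l (if l == j then 'X else 0) ^+ m l.
  by rewrite /h /= mmapX.
have p0 := prime_preimage h (zero_ideal_prime {poly k}).
have p1 := prime_preimage h (prime_preimage (horner_eval (0 : k)) (zero_ideal_prime k)).
have /seteqP [_ /(_ 'X_j)] : h @^-1` [set 0] =
    h @^-1` (horner_eval (0 : k) @^-1` [set 0]).
  apply: dim0 => // f; last first.
    by rewrite /preimage /= => ->; rewrite /horner_eval horner0.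
  move=> If; apply: ideal_from_supp => [|m mf]; first by case: p0.
  rewrite /preimage /= hX.
  have [/existsP [l /andP [lj ml]]|] := boolP [exists l, (l != j) && (m l != 0%N)].
    by rewrite (bigD1 l) //= (negPf lj) expr0n (negPf ml) mul0r.
  rewrite negb_exists => /forallP m0; case: noN; exists (m j).
  have -> : 'X_j ^+ m j = 'X_[m] :> R; last exact: monomial_ideal_supp mf.
  rewrite mpolyXn; congr 'X_[_]; apply/mnmP => l; rewrite mulmnE mnm1E.
  have := m0 l; rewrite eq_sym; case: eqP => [->|_] /=; first by rewrite mul1n.
  by rewrite negbK => /eqP ->.
have hXj : h 'X_j = 'X by rewrite /h /= mmapX mmap1U eqxx.
rewrite /preimage /= hXj /horner_eval hornerX => /(_ erefl) /eqP.
by rewrite polyX_eq0.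
Qed.

End MonomialIdeals.

(** * Rees rings and integral closure *)

Section ReesElements.
Variables (A : comNzRingType) (J : set A).

Lemma ideal_exp1 (L : set A) x : L x -> ideal_exp L 1 x.
Proof. by move=> Lx; apply: sub_ideal_gen; exists x => //; exists 1 => //; rewrite mulr1. Qed.

Lemma sub_integral_closure (L : set A) : is_ideal L -> L `<=` integral_closure L.
Proof.
move=> iL x Lx; exists 1%N, (fun=> - x); split=> [[|[|]] // _|].
  apply: ideal_exp1; rewrite -mulN1r.
  by case: iL => _ _; apply.
by rewrite big_nat1 expr1 mulr1 subrr.
Qed.

Lemma rees_reesbar F : F \in rees_pred J -> F \in reesbar_pred J.
Proof.
move=> /asboolP JF; apply/asboolP => j; apply: sub_integral_closure => //.
exact: ideal_expP.
Qed.

Lemma rees_homog j f : ideal_exp J j f -> f%:P * 'X^j \in rees_pred J.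
Proof.
move=> Jf; apply/asboolP => i; rewrite coefCM coefXn.
by case: eqP => [->|_]; rewrite ?mulr1 // mulr0; case: (ideal_expP J i).
Qed.

Definition rees_elt j f : rees J := insubd 0 (f%:P * 'X^j).

Lemma val_rees_elt j f : ideal_exp J j f -> (rees_elt j f : {poly A}) = f%:P * 'X^j.
Proof. by move=> Jf; apply: insubdK; apply: rees_homog. Qed.

Lemma rees_val_inj : injective (@rees_val A J).
Proof. exact: val_inj. Qed.

Lemma rees_valD (x y : rees J) : rees_val (x + y) = rees_val x + rees_val y.
Proof. by []. Qed.

Lemma rees_valM (x y : rees J) : rees_val (x * y) = rees_val x * rees_val y.
Proof. by []. Qed.

Lemma rees_valX (x : rees J) m : rees_val (x ^+ m) = rees_val x ^+ m.
Proof. by elim: m => // m IH; rewrite !exprS rees_valM IH. Qed.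

Lemma rees_val_sum (T : Type) (s : seq T) (F : T -> rees J) :
  rees_val (\sum_(i <- s) F i) = \sum_(i <- s) rees_val (F i).
Proof. by elim: s => [|i s IH]; rewrite ?big_nil // !big_cons rees_valD IH. Qed.

Definition reesbar_of_rees (F : rees J) : reesbar J :=
  Reesbar (rees_reesbar (valP F)).

Lemma reesbar_val_inj : injective (@reesbar_val A J).
Proof. exact: val_inj. Qed.

Lemma reesbar_valM (x y : reesbar J) :
  reesbar_val (x * y) = reesbar_val x * reesbar_val y.
Proof. by []. Qed.

Lemma reesbar_valX (x : reesbar J) m : reesbar_val (x ^+ m) = reesbar_val x ^+ m.
Proof. by elim: m => // m IH; rewrite !exprS reesbar_valM IH. Qed.

End ReesElements.

Section IntegralClosure.
Variables (A : comNzRingType) (J : set A).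

Lemma integral_closure_expD j f g :
  integral_closure (ideal_exp J j) f -> integral_closure (ideal_exp J j) g ->
  integral_closure (ideal_exp J j) (f + g).
Proof.
move=> /integral_homogeneous jf /integral_homogeneous jg.
by apply/integral_homogeneous; rewrite polyCD mulrDl; apply: integral_add.
Qed.

Lemma integral_closure_expM i j f g :
  integral_closure (ideal_exp J i) f -> integral_closure (ideal_exp J j) g ->
  integral_closure (ideal_exp J (i + j)) (f * g).
Proof.
move=> /integral_homogeneous jf /integral_homogeneous jg.
apply/integral_homogeneous; rewrite polyCM exprD mulrACA.
exact: integral_mul.
Qed.

Lemma integral_closure_exp0 j : integral_closure (ideal_exp J j) 0.
Proof.
by apply: sub_integral_closure; [apply: ideal_expP | case: (ideal_expP J j)].
Qed.

Lemma ideal_exp_anti i j f : (i <= j)%N -> ideal_exp J j f -> ideal_exp J i f.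
Proof.
move=> /subnKC <-; elim: (j - i)%N f => [|c IH] f; first by rewrite addn0.
rewrite addnS => Jf; apply: IH; apply: Jf; first exact: ideal_expP.
by move=> _ [x _ [y Jy <-]]; case: (ideal_expP J (i + c)) => _ _; apply.
Qed.

Lemma ideal_exp_pow j m f : ideal_exp J j f -> ideal_exp J (j * m) (f ^+ m).
Proof.
move=> Jf; elim: m => [|m IH]; first by rewrite muln0.
by rewrite exprS mulnS; apply: ideal_expD.
Qed.

(** For f in J^b, an equation of integral dependence of f over J^(b+1) writes a
    power of f as a sum of elements of the next higher power of J. *)
Lemma integral_pow_exp b f : ideal_exp J b f ->
  integral_closure (ideal_exp J b.+1) f ->
  exists m, ideal_exp J (b * m).+1 (f ^+ m).
Proof.
move=> Jf [m [a [Ja /eqP]]]; rewrite addr_eq0 => /eqP fm; exists m.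
have iJ := ideal_expP J (b * m).+1.
rewrite fm -mulN1r; case: (iJ) => _ _; apply.
rewrite big_nat_cond; apply: ideal_sum => // i; rewrite andbT => im.
apply: (@ideal_exp_anti _ (b.+1 * i + b * (m - i))); first by nia.
by apply: ideal_expD; [apply/ideal_expM/Ja; lia | apply: ideal_exp_pow].
Qed.

End IntegralClosure.

(** Multiplying by J raises the degree of integrality by one. *)
Lemma reesbar_ext_coef (A : idomainType) (J : set A) (F : reesbar J) j :
  @reesbar_ext _ J F -> integral_closure (ideal_exp J j.+1) F`_j.
Proof.
pose L := [set F : reesbar J | forall j, integral_closure (ideal_exp J j.+1) F`_j].
suff iL : is_ideal L.
  move=> /(_ L iL); apply=> _ [f Jf <-] {}j.
  rewrite (_ : (reesbar_const J f : {poly A}) = f%:P) // coefC.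
  case: eqP => [->|_]; last exact: integral_closure_exp0.
  apply: sub_integral_closure; [exact: ideal_expP | exact: ideal_exp1].
split=> [i|F1 F2 F1L F2L i|F1 F2 F2L i].
- by rewrite [reesbar_val 0]rmorph0 coef0; apply: integral_closure_exp0.
- by rewrite [reesbar_val _]rmorphD coefD; apply: integral_closure_expD.
rewrite reesbar_valM coefM; elim/big_rec: _ => [|c x _ Lx].
  exact: integral_closure_exp0.
apply: integral_closure_expD => //.
have e : (c + (i - c).+1)%N = i.+1 by rewrite addnS subnKC // -ltnS.
suff : integral_closure (ideal_exp J (c + (i - c).+1)) (F1`_c * F2`_(i - c)).
  by rewrite e.
apply: integral_closure_expM => //.
by case: (F1) => h /= /asboolP.
Qed.

Section ReesHomogeneous.
Variables (A : comNzRingType) (I : set A).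

Lemma rees_eltD j f g : ideal_exp I j f -> ideal_exp I j g ->
  rees_elt I j (f + g) = rees_elt I j f + rees_elt I j g.
Proof.
move=> jf jg; apply: rees_val_inj; rewrite rees_valD !val_rees_elt //.
  by rewrite polyCD mulrDl.
by case: (ideal_expP I j) => _ + _; apply.
Qed.

Lemma rees_eltM i j f g : ideal_exp I i f -> ideal_exp I j g ->
  rees_elt I (i + j) (f * g) = rees_elt I i f * rees_elt I j g.
Proof.
move=> jf jg; apply: rees_val_inj; rewrite rees_valM !val_rees_elt //.
  by rewrite polyCM exprD mulrACA.
exact: ideal_expD.
Qed.

Lemma rees_eltX j m f : ideal_exp I j f ->
  rees_elt I j f ^+ m = rees_elt I (j * m) (f ^+ m).
Proof.
move=> jf; elim: m => [|m IH]; last first.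
  by rewrite !exprS mulnS rees_eltM ?IH //; apply: ideal_exp_pow.
by rewrite !expr0 muln0; apply: rees_val_inj; rewrite val_rees_elt // mul1r.
Qed.

Lemma rees_elt0 f : rees_elt I 0 f = rees_const I f.
Proof. by apply: rees_val_inj; rewrite val_rees_elt // expr0 mulr1. Qed.

End ReesHomogeneous.

(** * Rees valuations are monomial *)

Lemma tofrac_divV (B : idomainType) (x a b : B) :
  x != 0 -> b != 0 -> (tofrac x)^-1 = tofrac a / tofrac b -> b = a * x.
Proof.
rewrite -!(tofrac_eq0 x) -!(tofrac_eq0 b) => x0 b0.
move=> /(congr1 ( *%R^~ (tofrac b))); rewrite divfK // => e.
by apply/eqP; rewrite -tofrac_eq tofracM -e mulrAC mulVf // mul1r.
Qed.

Section Valuations.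
Variables (K : fieldType) (w : K -> int).
Hypothesis wV : normalized_valuation w.

Lemma valuationM x y : x != 0 -> y != 0 -> w (x * y) = w x + w y.
Proof. by case: wV => wM _ _; apply: wM. Qed.

Lemma valuation1 : w 1 = 0.
Proof.
have := @valuationM 1 1 (oner_neq0 _) (oner_neq0 _); rewrite mulr1 => e.
by lia.
Qed.

Lemma valuationV x : x != 0 -> w x^-1 = - w x.
Proof.
move=> x0; have := valuationM x0 (invr_neq0 x0).
by rewrite divff // valuation1; lia.
Qed.

Lemma valuationX x m : x != 0 -> w (x ^+ m) = w x *+ m.
Proof.
move=> x0; elim: m => [|m IH]; first by rewrite expr0 valuation1.
by rewrite exprS mulrS valuationM ?IH // expf_neq0.
Qed.

Lemma valuation_prod (T : Type) (r : seq T) (F : T -> K) :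
  (forall i, F i != 0) -> w (\prod_(i <- r) F i) = \sum_(i <- r) w (F i).
Proof.
move=> F0; have : \prod_(i <- r) F i != 0 /\ w (\prod_(i <- r) F i) = \sum_(i <- r) w (F i).
  elim: r => [|i r [nz e]]; first by rewrite !big_nil oner_neq0 valuation1.
  by rewrite !big_cons mulf_neq0 // valuationM // e.
by case.
Qed.

Definition vge c x := x = 0 \/ c <= w x.

Lemma vge_sum c (T : Type) (r : seq T) (F : T -> K) :
  (forall i, vge c (F i)) -> vge c (\sum_(i <- r) F i).
Proof.
move=> cF; elim/big_rec: _ => [|i x _ cx]; first by left.
have [x0|x0] := eqVneq x 0; first by rewrite x0 addr0.
have [F0|F0] := eqVneq (F i) 0; first by rewrite F0 add0r.
have [s0|s0] := eqVneq (F i + x) 0; first by left.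
right; case: wV => _ + _ => /(_ _ _ F0 x0 s0); apply: le_trans.
rewrite le_min; apply/andP; split.
  by case: (cF i) => // e; rewrite e eqxx in F0.
by case: cx => // e; rewrite e eqxx in x0.
Qed.

End Valuations.

Section Center.
Variables (A : idomainType) (J : set A) (v : {fraction {poly A}} -> int).
Variable Q : set (reesbar J).
Hypotheses (vV : normalized_valuation v) (pQ : prime_ideal Q).
Hypothesis vQ : valuation_ring v = reesbar_loc Q.
Implicit Types g : reesbar J.

Lemma valuation_reesbar_ge0 g : (g : {poly A}) != 0 -> 0 <= v (tofrac (g : {poly A})).
Proof.
move=> g0; have : valuation_ring v (tofrac (g : {poly A})).
  rewrite vQ; exists g, 1; split; first by case: pQ.
  by rewrite [reesbar_val 1]rmorph1 tofrac1 divr1.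
by case=> // /eqP; rewrite tofrac_eq0 (negPf g0).
Qed.

(** The valuation ring of v is the localization at Q, so v is positive exactly
    on Q. *)
Lemma center_gt0 g : (g : {poly A}) != 0 ->
  Q g <-> 0 < v (tofrac (g : {poly A})).
Proof.
move=> g0; have Tg0 : tofrac (g : {poly A}) != 0 by rewrite tofrac_eq0.
have vg := valuation_reesbar_ge0 g0; have [[Q0 _ QM] Q1 _] := pQ.
split=> [Qg|].
  rewrite lt_neqAle vg andbT eq_sym; apply/eqP => vg0.
  have : valuation_ring v (tofrac (g : {poly A}))^-1.
    by right; rewrite valuationV // vg0 oppr0.
  rewrite vQ => -[a [b [nQb e]]]; apply: nQb.
  have [b0|b0] := eqVneq (b : {poly A}) 0.
    by have -> : b = 0 by apply: val_inj.
  have -> : b = a * g; last exact: QM.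
  by apply: reesbar_val_inj; rewrite reesbar_valM; apply: tofrac_divV e.
move=> vg0; apply: contrapT => nQg.
have : valuation_ring v (tofrac (g : {poly A}))^-1.
  rewrite vQ; exists 1, g; split=> //.
  by rewrite [reesbar_val 1]rmorph1 tofrac1 mul1r.
case=> [/eqP|]; first by rewrite invr_eq0 (negPf Tg0).
by rewrite valuationV //; lia.
Qed.

Lemma center_eq0 g : ~ Q g -> v (tofrac (g : {poly A})) = 0.
Proof.
move=> nQg; have g0 : (g : {poly A}) != 0.
  apply: contra_notN nQg => /eqP g0; have -> : g = 0 by apply: val_inj.
  by case: pQ => -[].
apply/eqP; rewrite eq_le valuation_reesbar_ge0 // andbT leNgt; apply/negP => vg.
by apply: nQg; apply/center_gt0.
Qed.

End Center.

Lemma weight_slope (c d j : nat) (t : int) :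
  (d * j < c)%N -> - d%:Z <= t -> 1 <= c%:Z + j%:Z * t.
Proof.
move=> dj dt; have : 0 <= j%:Z * (t + d%:Z) by apply: mulr_ge0; lia.
rewrite mulrDr -PoszM mulnC; move: (j%:Z * t) => u; lia.
Qed.

Section MonomialValuations.
Variables (k : fieldType) (n : nat) (n_gt0 : (0 < n)%N).
Local Notation R := {mpoly k[n]}.
Variables (I : set R) (v : {fraction {poly R}} -> int) (Q : set (reesbar I)).
Hypotheses (I_monomial : monomial_ideal I) (I_dim0 : zero_dimensional I).
Hypotheses (vV : normalized_valuation v) (vQ : valuation_ring v = reesbar_loc Q).
Hypothesis minQ : minimal_prime_over (@reesbar_ext _ I) Q.

Let pQ : prime_ideal Q. Proof. by case: minQ. Qed.
Let I1 : ~ I 1 := zero_dimensional_proper I_dim0.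

Local Notation X m := ('X_[k, m] : R).
Local Notation term m j := (tofrac ((X m)%:P * 'X^j : {poly R})).

Let X_neq0 m : X m != 0.
Proof.
by apply/eqP => /mpolyP/(_ m); rewrite mcoeffX eqxx mcoeff0 => /eqP; rewrite oner_eq0.
Qed.

Let term_neq0 m j : (X m)%:P * 'X^j != 0 :> {poly R}.
Proof. by rewrite mulf_eq0 polyC_eq0 (negPf (X_neq0 m)) expf_eq0 polyX_eq0 andbF. Qed.

Let valuation_const (c : k) : c != 0 -> val_of v (c%:MP : R) = 0.
Proof.
move=> c0; have ge0 (a : k) : a != 0 -> 0 <= val_of v (a%:MP : R).
  move=> a0; apply: (valuation_reesbar_ge0 pQ vQ (g := reesbar_const I a%:MP)).
  by rewrite /= polyC_eq0 mpolyC_eq0.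
have nz (a : k) : a != 0 -> tofrac ((a%:MP : R)%:P) != 0.
  by rewrite tofrac_eq0 polyC_eq0 mpolyC_eq0.
have : val_of v (c%:MP : R) + val_of v (c^-1%:MP : R) = 0.
  rewrite /val_of -(valuationM vV) ?nz ?invr_neq0 //.
  by rewrite -tofracM -polyCM -mpolyCM divff // mpolyC1 polyC1 tofrac1 valuation1.
have := ge0 _ c0; have := ge0 _ (invr_neq0 c0).
move: (val_of _ _) (val_of _ _) => a b; lia.
Qed.

Let vge_terms c (g : {poly R}) :
  (forall j m, m \in msupp g`_j -> c <= v (term m j)) -> vge v c (tofrac g).
Proof.
move=> cg; rewrite -[g]coefK poly_def raddf_sum /=; apply: (vge_sum vV) => j.
rewrite [g`_j]mpolyE scaler_suml raddf_sum /=; apply: (vge_sum vV) => m.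
have [mg|mg] := boolP (m \in msupp g`_j); last first.
  by rewrite (memN_msupp_eq0 mg) !scale0r raddf0; left.
right; rewrite -mul_mpolyC -mul_polyC polyCM -mulrA tofracM.
have c0 : (g`_j)@_m != 0 by rewrite -mcoeff_msupp.
rewrite valuationM ?tofrac_eq0 ?polyC_eq0 ?mpolyC_eq0 ?term_neq0 //.
by have := valuation_const c0; rewrite /val_of => ->; rewrite add0r cg.
Qed.

Let l (i : 'I_n) : nat := `|val_of v ('X_i : R)|%N.

Let ext_in_Q f : I f -> Q (reesbar_const I f).
Proof. by move=> If; case: minQ => _ + _; apply; apply: sub_ideal_gen; exists f. Qed.

Let valX_gt0 i : 0 < val_of v ('X_i : R).
Proof.
have [N IN] := zero_dimensional_power i I_monomial I_dim0.
have QX : Q (reesbar_const I 'X_i).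
  apply: (prime_expr (m := N) pQ); have := ext_in_Q IN; congr Q.
  by apply: reesbar_val_inj; rewrite /= rmorphXn /= [RHS]rmorphXn.
apply: (iffLR (center_gt0 vV pQ vQ (g := reesbar_const I 'X_i) _)) => //=.
by rewrite polyC_eq0.
Qed.

Let l_gt0 i : (0 < l i)%N.
Proof. by have := valX_gt0 i; rewrite /l; lia. Qed.

Let val_mon m : val_of v (X m) = (wt l m)%:Z.
Proof.
have nz i : tofrac (('X_i : R)%:P) != 0 by rewrite tofrac_eq0 polyC_eq0 X_neq0.
rewrite /val_of mpolyXE_id rmorph_prod rmorph_prod /= (valuation_prod vV); last first.
  move=> i; by rewrite rmorphXn tofracXn; apply/expf_neq0/nz.
rewrite /wt (big_morph Posz PoszD (erefl _)); apply: eq_bigr => i _ /=.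
rewrite rmorphXn tofracXn (valuationX vV) //; last exact: nz.
have := valX_gt0 i; rewrite /l /val_of => vi.
by rewrite PoszM gtz0_abs // -mulr_natl natz.
Qed.

Let val_term m j : v (term m j) = (wt l m)%:Z + v (tofrac 'X) *+ j.
Proof.
rewrite tofracM (valuationM vV) ?tofrac_eq0 ?polyC_eq0 ?X_neq0 //; last first.
  by rewrite expf_eq0 polyX_eq0 andbF.
by rewrite tofracXn (valuationX vV) ?tofrac_eq0 ?polyX_eq0 // -val_mon.
Qed.

Let I_wge d : (forall m, I (X m) -> (d <= wt l m)%N) -> I `<=` wge (wt l) d.
Proof. by move=> Id f If m mf; apply/Id/(monomial_ideal_supp I_monomial If mf). Qed.

Let I_wt_gt0 m : I (X m) -> (0 < wt l m)%N.
Proof.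
move=> Im; apply: wt_gt0 => //; apply/eqP => m0; apply: I1.
by rewrite -mpolyX0 -m0.
Qed.

(** The center of the monomial valuation with the weights v(x_i) is a prime
    containing I and contained in Q, hence equal to Q by minimality; this also
    forces v(t) = - v(I), because otherwise Q would contain x^a t for a monomial
    x^a of minimal weight in I. *)
Lemma rees_valuation_monomial : exists l : 'I_n -> nat, exists d : nat,
  [/\ forall i, (0 < l i)%N, I `<=` wge (wt l) d,
      exists2 a, I (X a) & wt l a = d,
      Q = [set F : reesbar I | face_part (wt l) d F = 0] &
      (forall a, val_of v (X a) = (wt l a)%:Z) /\ ideal_value I v = d%:Z].
Proof.
have [N IN] := zero_dimensional_power (Ordinal n_gt0) I_monomial I_dim0.
have [|d] := @ex_minnP (fun d => `[< exists2 m, I (X m) & wt l m = d >]).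
  exists (wt l (U_(Ordinal n_gt0) *+ N)%MM); apply/asboolP.
  by exists (U_(Ordinal n_gt0) *+ N)%MM; rewrite -?mpolyXn.
move=> /asboolP [a Ia wa] dmin.
have Id : I `<=` wge (wt l) d by apply: I_wge => m Im; apply/dmin/asboolP; exists m.
have at_rees : (X a)%:P * 'X^1 \in reesbar_pred I.
  exact: rees_reesbar (rees_homog (ideal_exp1 Ia)).
pose at1 : reesbar I := Reesbar at_rees.
have at1_neq0 : (at1 : {poly R}) != 0 := term_neq0 a 1.
have tau_ge : - (d%:Z) <= v (tofrac 'X).
  have := valuation_reesbar_ge0 pQ vQ at1_neq0.
  by rewrite /= val_term wa mulr1n; lia.
have Id' := reesbar_halfspace Id.
have QE : Q = [set F : reesbar I | face_part (wt l) d F = 0].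
  case: minQ => _ _ Qmin; apply/esym/Qmin; first exact: reesbar_center_prime Id.
    move=> F; apply; first by case: (reesbar_center_prime Id).
    move=> _ [f If <-]; apply/face_part_eq0 => // j m.
    rewrite /= coefC; case: eqP => [->|_]; last by rewrite msupp0.
    by move/(monomial_ideal_supp I_monomial If)/I_wt_gt0; rewrite muln0.
  move=> F /(face_part_eq0 (Id' F)) F0.
  have [F00|Fn0] := eqVneq (F : {poly R}) 0.
    have -> : F = 0 by apply: reesbar_val_inj.
    by case: pQ => -[].
  apply/(center_gt0 vV pQ vQ Fn0).
  suff [/eqP|] : vge v 1 (tofrac (F : {poly R})).
  - by rewrite tofrac_eq0 (negPf Fn0).
  - exact: lt_le_trans.
  apply: vge_terms => j m /F0 dj; rewrite val_term -mulr_natl natz.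
  exact: weight_slope tau_ge.
exists l, d; split=> //; first by exists a.
split=> //.
have tauE : v (tofrac 'X) = - (d%:Z).
  have /(center_eq0 vV pQ vQ) : ~ Q at1.
    rewrite QE => /(congr1 (fun F : {poly R} => F`_1)).
    rewrite coef_face_part coef0 /= expr1 coefMX coefC /= muln1 pihomogX.
    case: eqP => [_|/(_ wa) //].
    by move/eqP; rewrite (negPf (X_neq0 a)).
  by rewrite /= val_term wa mulr1n; lia.
have vI f : I f -> f != 0 -> d%:Z <= val_of v f.
  move=> If f0; have [/eqP|//] : vge v d%:Z (tofrac f%:P).
    apply: vge_terms => j m; rewrite coefC.
    case: eqP => [-> mf|_]; last by rewrite msupp0.
    by rewrite val_term mulr0n addr0 lez_nat (Id f).
  by rewrite tofrac_eq0 polyC_eq0 (negPf f0).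
rewrite /ideal_value; apply: xget_unique; last first.
  move=> e [[f [If f0 <-]] fmin].
  by apply/eqP; rewrite eq_le -{1}wa -val_mon fmin //= vI.
by split=> //; exists (X a); split=> //; rewrite val_mon wa.
Qed.

End MonomialValuations.

(** * Comparing the centers *)

Section Centers.
Variables (k : fieldType) (n : nat).
Local Notation R := {mpoly k[n]}.
Variable I : set R.
Hypothesis I_monomial : monomial_ideal I.

(** A monomial of I of least weight is a multiple of a minimal generator, whose
    weight cannot be smaller. *)
Lemma face_nonempty (l : 'I_n -> nat) d : I `<=` wge (wt l) d ->
  (exists2 a, I 'X_[a] & wt l a = d) -> exists2 a, mingen I a & wt l a = d.
Proof.
move=> Id [a /mingen_le [b gb ba] wa]; exists b => //.
have := Id _ gb.1 b; rewrite msuppX inE eqxx => /(_ isT) le.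
apply/eqP; rewrite eqn_leq; apply/andP; split; last exact: le.
by rewrite -wa -(submK ba) wtD leq_addl.
Qed.

(** If the face of weight l2 lies in the face of weight l1, then M l2 - l1 is
    for large M a weight function with minimum M d2 - d1 on I. As M l2 is the sum
    of this weight function and of l1, a term of an element of Rbar that is off
    the hyperplane of l1 is also off that of l2. *)
Lemma center_sub (l1 l2 : 'I_n -> nat) d1 d2 r (alpha : 'I_r -> 'X_{1..n}) :
  (forall a, mingen I a <-> exists j, alpha j = a) ->
  (forall i, (0 < l2 i)%N) ->
  I `<=` wge (wt l1) d1 -> I `<=` wge (wt l2) d2 ->
  (exists2 a, I 'X_[a] & wt l2 a = d2) ->
  (forall j, wt l2 (alpha j) = d2 -> wt l1 (alpha j) = d1) ->
  [set F : reesbar I | face_part (wt l1) d1 F = 0] `<=`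
  [set F : reesbar I | face_part (wt l2) d2 F = 0].
Proof.
move=> gens l2_gt0 I1 I2 ne sub.
(* large enough both for l to be nonnegative and for l to be at least d on the
   generators off the face of l2 *)
pose M := (\sum_i l1 i + \sum_j wt l1 (alpha j))%N.
pose l i := (M * l2 i - l1 i)%N.
have Ml i : (l i + l1 i = M * l2 i)%N.
  rewrite subnK // (@leq_trans M) ?leq_pmulr // /M (bigD1 i) //=.
  by rewrite -addnA leq_addr.
have Mwt a : (wt l a + wt l1 a = M * wt l2 a)%N.
  rewrite /wt -big_split big_distrr; apply: eq_bigr => i _ /=.
  by rewrite -mulnDr Ml mulnCA.
have [_ /gens [j <-] wj] := face_nonempty I2 ne.
pose d := (M * d2 - d1)%N.
have Md : (d + d1 = M * d2)%N.
  by rewrite subnK // -wj -Mwt (sub _ wj) leq_addl.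
have Il : I `<=` wge (wt l) d.
  apply: monomial_ideal_mingen => //; first exact: wge_ideal.
  move=> _ /gens [i <-] m; rewrite msuppX inE => /eqP ->.
  have gi : mingen I (alpha i) by apply/gens; exists i.
  have := I2 _ gi.1 (alpha i); rewrite msuppX inE eqxx => /(_ isT).
  have := Mwt (alpha i); rewrite /= leq_eqVlt => e /orP [/eqP w2|w2].
    by have := sub i (esym w2); nia.
  have : (wt l1 (alpha i) <= M)%N.
    by rewrite /M (bigD1 i) //= addnCA leq_addr.
  nia.
move=> F /(face_part_eq0 (reesbar_halfspace I1 (F:=F))) F1.
apply/(face_part_eq0 (reesbar_halfspace I2 (F:=F))) => c m mF.
have := F1 c m mF; have := reesbar_halfspace Il mF.
have := reesbar_halfspace I2 mF; have := Mwt m => /=.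
move: (wt l m) (wt l1 m) (wt l2 m) => u u1 u2; nia.
Qed.

End Centers.

(** * Nilpotent elements of the fiber ring *)

Section Nilpotence.
Variables (k : fieldType) (n : nat).
Local Notation R := {mpoly k[n]}.
Variable I : set R.

Lemma fiber_ideal_elt j f : I `<=` @maxideal k n ->
  ideal_exp I j.+1 f -> ideal_gen (rees_const I @` @maxideal k n) (rees_elt I j f).
Proof.
move=> Im If; set L := ideal_gen _.
have iL : is_ideal L by apply: ideal_genP.
have [L0 LD LM] := iL; have [J0 JD JM] := ideal_expP I j.
suff [] : [set f | ideal_exp I j f /\ L (rees_elt I j f)] f by [].
apply: If; first split.
- split=> //; have -> // : rees_elt I j 0 = 0.
  by apply: rees_val_inj; rewrite val_rees_elt // mul0r.
- move=> x y [Jx Lx] [Jy Ly]; split; first exact: JD.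
  by rewrite rees_eltD //; apply: LD.
- move=> a x [Jx Lx]; split; first exact: JM.
  by rewrite -(add0n j) rees_eltM //; apply: LM.
move=> _ [u Iu [y Jy <-]]; split; first exact: JM.
rewrite -(add0n j) rees_eltM // mulrC; apply: LM.
by rewrite rees_elt0; apply: sub_ideal_gen; exists u => //; apply: Im.
Qed.

(** A homogeneous element f t^b of R(I) that lies in every minimal prime of
    I Rbar has a power in I Rbar; then a power of f is integral over the next
    higher power of I, and by integral_pow_exp a further power belongs to it. *)
Lemma rees_nilpotent s (Q : 'I_s -> set (reesbar I)) b f :
  I `<=` @maxideal k n ->
  (forall P, minimal_prime_over (@reesbar_ext _ I) P -> exists i, Q i = P) ->
  ideal_exp I b f -> (forall i, Q i (reesbar_of_rees (rees_elt I b f))) ->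
  exists N, ideal_gen (rees_const I @` @maxideal k n) (rees_elt I b f ^+ N).
Proof.
move=> Im Qmin Jf Qf; set g := reesbar_of_rees _ in Qf.
have [N] : exists N, @reesbar_ext _ I (g ^+ N).
  apply: contrapT => /forallNP noN.
  have [P /Qmin [i <-] nQ] := minimal_prime_avoiding (ideal_genP _) noN.
  exact: nQ.
have gN : reesbar_val (g ^+ N) = (f ^+ N)%:P * 'X^(b * N).
  by rewrite reesbar_valX /= val_rees_elt // exprMn -exprM -rmorphXn.
move=> /(reesbar_ext_coef (b * N)); rewrite gN coefMXn ltnn subnn coefC /=.
have JfN : ideal_exp I (b * N) (f ^+ N) by apply: ideal_exp_pow.
move=> /(integral_pow_exp JfN) [m Jm]; exists (N * m)%N.
by rewrite exprM rees_eltX // rees_eltX //; apply: fiber_ideal_elt.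
Qed.

End Nilpotence.

(** * Presentations of the fiber ring *)

Lemma ideal_quot_eq0 (A : comNzRingType) (L : idealr A) x :
  \pi_({ideal_quot L})%qT x = 0 <-> x \in L.
Proof.
have e := Quotient.idealrBE L x 0; rewrite subr0 in e.
by rewrite e; split=> [->|/eqP ->]; rewrite rmorph0.
Qed.

(** This reduces an identity between ring morphisms on a polynomial ring to the
    constants and the variables, without any computation on monomials. *)
Lemma mpoly_ring_ind (A : comNzRingType) r (P : {mpoly A[r]} -> Prop) :
  (forall c, P c%:MP) -> (forall i, P 'X_i) ->
  (forall p q, P p -> P q -> P (p + q)) ->
  (forall p q, P p -> P q -> P (p * q)) -> forall p, P p.
Proof.
move=> PC PX PD PM p; rewrite [p]mpolyE; elim/big_rec: _ => [|m x _ Px].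
  by rewrite -mpolyC0.
apply: (PD) => //; rewrite -mul_mpolyC; apply: (PM) => //.
rewrite mpolyXE_id; elim/big_rec: _ => [|i y _ Py]; first by rewrite -mpolyC1.
apply: (PM) => //; elim: (m i) => [|c IH]; first by rewrite expr0 -mpolyC1.
by rewrite exprS; apply: PM.
Qed.

Section FiberQuotient.
Variables (k : fieldType) (n : nat).
Local Notation R := {mpoly k[n]}.
Local Notation mI I := (ideal_gen (rees_const I @` @maxideal k n)).
Implicit Types I : set R.

Definition fiber_proj I : {rmorphism rees I -> fiber I} := \pi_(fiber I)%qT.

Lemma fiber_proj_eq0 I x : fiber_proj I x = 0 <-> mI I x.
Proof. by rewrite ideal_quot_eq0; split=> /asboolP. Qed.

Lemma fiber_proj_surj I z : exists x, fiber_proj I x = z.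
Proof. by exists (repr z); rewrite /fiber_proj /= reprK. Qed.

Lemma reduced_eq0 (A : comNzRingType) (z : A) :
  \pi_(reduced A)%qT z = 0 <-> exists m, z ^+ m = 0.
Proof. by rewrite ideal_quot_eq0; split=> /asboolP. Qed.

Definition rees_coef I (c : k) : rees I := rees_const I c%:MP.

Lemma rees_coef_is_zmod_morphism I : zmod_morphism (rees_coef I).
Proof. by move=> x y; apply: rees_val_inj; rewrite /= mpolyCB polyCB. Qed.

Lemma rees_coef_is_monoid_morphism I : monoid_morphism (rees_coef I).
Proof.
split=> [|x y]; apply: rees_val_inj; first by rewrite /= mpolyC1 polyC1.
by rewrite rees_valM /= mpolyCM polyCM.
Qed.

HB.instance Definition _ I :=
  GRing.isZmodMorphism.Build _ _ (rees_coef I) (rees_coef_is_zmod_morphism I).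
HB.instance Definition _ I :=
  GRing.isMonoidMorphism.Build _ _ (rees_coef I) (rees_coef_is_monoid_morphism I).

(** The two maps below are locked: comparing their values at different
    polynomials must not unfold them. *)
Fact map_key : unit. Proof. by []. Qed.

Section Maps.
Variables (m : nat) (alpha : 'I_m -> 'X_{1..n}).

Definition rees_map I : {rmorphism {mpoly k[m]} -> rees I} :=
  locked_with map_key
    (mmap (rees_coef I) (fun j => rees_mon I (alpha j)) : {rmorphism _ -> _}).

Definition mon_map : {rmorphism {mpoly k[m]} -> {poly R}} :=
  locked_with map_key
    (mmap (@polyC R \o @mpolyC n k) (fun j => ('X_[alpha j])%:P * 'X)
     : {rmorphism _ -> _}).

Lemma rees_map_mmap I p :
  rees_map I p = mmap (rees_coef I) (fun j => rees_mon I (alpha j)) p.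
Proof. by rewrite /rees_map locked_withE. Qed.

Lemma rees_mapC I c : rees_map I c%:MP = rees_coef I c.
Proof. by rewrite rees_map_mmap; apply: mmapC. Qed.

Lemma rees_mapX I j : rees_map I 'X_j = rees_mon I (alpha j).
Proof. by rewrite rees_map_mmap mmapX mmap1U. Qed.

Lemma mon_mapC c : mon_map c%:MP = c%:MP%:P.
Proof. by rewrite /mon_map unlock; apply: mmapC. Qed.

Lemma mon_mapX j : mon_map 'X_j = ('X_[alpha j])%:P * 'X.
Proof. by rewrite /mon_map unlock /= mmapX mmap1U. Qed.

Lemma mon_mapD p q : mon_map (p + q) = mon_map p + mon_map q.
Proof. exact: rmorphD. Qed.

Lemma mon_mapM p q : mon_map (p * q) = mon_map p * mon_map q.
Proof. exact: rmorphM. Qed.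

Lemma mon_map_exp p N : mon_map (p ^+ N) = mon_map p ^+ N.
Proof. exact: rmorphXn. Qed.

Lemma val_rees_mon I a : I 'X_[a] -> rees_val (rees_mon I a) = ('X_[a])%:P * 'X.
Proof. by move=> Ia; apply: (val_rees_elt (ideal_exp1 Ia)). Qed.

Lemma rees_mapE I p : (forall j, I 'X_[alpha j]) ->
  rees_val (rees_map I p) = mon_map p.
Proof.
move=> Ia; elim/mpoly_ring_ind: p => [c|j|p q IHp IHq|p q IHp IHq].
- by rewrite rees_mapC mon_mapC.
- by rewrite rees_mapX mon_mapX val_rees_mon.
- by rewrite [rees_map I _]rmorphD rees_valD IHp IHq [RHS]rmorphD.
- by rewrite [rees_map I _]rmorphM rees_valM IHp IHq [RHS]rmorphM.
Qed.

Lemma fiber_kerP I p :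
  fiber_ker I alpha p <-> exists N, mI I (rees_map I p ^+ N).
Proof.
rewrite /fiber_ker /mkset.
have -> : fiber_map I alpha p =
  \pi_(reduced (fiber I))%qT (fiber_proj I (rees_map I p)).
  by rewrite rees_map_mmap.
rewrite reduced_eq0; split=> -[N e]; exists N.
  by apply/fiber_proj_eq0; rewrite rmorphXn.
by rewrite -rmorphXn; apply/fiber_proj_eq0.
Qed.

End Maps.
End FiberQuotient.

(** * Faces of the fiber ring *)

Lemma comp_mpolyM (A : comNzRingType) m r (t : m.-tuple {mpoly A[r]}) p q :
  (p * q) \mPo t = (p \mPo t) * (q \mPo t).
Proof. exact: rmorphM. Qed.

Section Face.
Variables (k : fieldType) (n : nat).
Local Notation R := {mpoly k[n]}.
Local Notation mI I := (ideal_gen (rees_const I @` @maxideal k n)).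
Variables (l : 'I_n -> nat) (d : nat).
Hypothesis l_gt0 : forall i, (0 < l i)%N.
Local Notation fpart := (face_part (wt l) d).

Lemma mI_center (I : set R) F : I `<=` wge (wt l) d ->
  mI I F -> fpart F = 0.
Proof.
move=> Id; have [iC _ _] := rees_center_prime Id.
move=> /(_ _ iC); apply=> _ [f mf <-]; apply/face_part_eq0 => [|j m].
  exact: rees_halfspace.
rewrite /= coefC; case: eqP => [->|_]; last by rewrite msupp0.
move=> mm; rewrite muln0; apply: wt_gt0 => //.
apply: contraTneq mm => ->; rewrite mcoeff_msupp negbK.
by move: mf; rewrite maxidealE => ->.
Qed.

Section MonMap.
Variables (m : nat) (beta : 'I_m -> 'X_{1..n}).

Lemma mon_map_halfspace p : (forall j, (d <= wt l (beta j))%N) ->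
  halfspace (wt l) d (mon_map k beta p).
Proof.
move=> db; elim/mpoly_ring_ind: p => [c|j|p q IHp IHq|p q IHp IHq] i.
- rewrite mon_mapC coefC; case: eqP => [->|_] a; last by rewrite msupp0.
  by rewrite muln0.
- rewrite mon_mapX coefMX coefC; case: i => [|[|i]] a /=; rewrite ?msupp0 //.
  by rewrite muln1 msuppX inE => /eqP ->.
- by rewrite mon_mapD coefD; exact: (wgeD (IHp i) (IHq i)).
rewrite mon_mapM coefM; elim/big_rec: _ => [|c x _ IHx]; first exact: wge0.
apply: wgeD => //; have e : (d * i = d * c + d * (i - c))%N.
  by rewrite -mulnDr subnKC // -ltnS.
by rewrite e; apply: (wgeM (IHp c) (IHq (i - c)%N)).
Qed.

(** Monomials on the face only produce terms on the boundary hyperplane. *)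
Lemma mon_map_on_face p : (forall j, wt l (beta j) = d) ->
  fpart (mon_map k beta p) = mon_map k beta p.
Proof.
move=> bd; elim/mpoly_ring_ind: p => [c|j|p q IHp IHq|p q IHp IHq].
- rewrite mon_mapC; apply/polyP => i; rewrite coef_face_part coefC.
  case: eqP => [->|_]; last by rewrite pihomog0.
  rewrite muln0 pihomog_dE //; apply/dhomogP => a.
  by rewrite msuppC; case: eqP => // _; rewrite inE => /eqP ->; apply: mf0.
- rewrite mon_mapX; apply/polyP => i; rewrite coef_face_part coefMX coefC.
  case: i => [|[|i]] /=; rewrite ?pihomog0 // muln1 pihomogX.
  by case: eqP => // /(_ (bd j)).
- by rewrite mon_mapD face_partD IHp IHq.
by rewrite mon_mapM face_partM ?IHp ?IHq // => ?; apply: mon_map_halfspace => j;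
  rewrite bd.
Qed.

End MonMap.

Section FaceOfIdeal.
Variables (I : set R) (r : nat) (alpha : 'I_r -> 'X_{1..n}).
Variable v : {fraction {poly R}} -> int.
Hypothesis gens : forall a, mingen I a <-> exists j, alpha j = a.
Hypothesis Id : I `<=` wge (wt l) d.
Hypothesis v_wt : forall a, val_of v ('X_[a] : R) = (wt l a)%:Z.
Hypothesis vI : ideal_value I v = d%:Z.

Local Notation Y := (face_vars I alpha v).
Local Notation emb := (@face_emb k n I r alpha v).

Lemma face_varsP j : j \in Y = (wt l (alpha j) == d).
Proof. by rewrite inE v_wt vI eqz_nat. Qed.

Lemma alpha_in j : I 'X_[alpha j].
Proof. by have [] : mingen I (alpha j) by apply/gens; exists j. Qed.

Lemma alpha_wt j : (d <= wt l (alpha j))%N.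
Proof. by apply: (Id (alpha_in j)); rewrite msuppX inE. Qed.

Lemma face_ideal_wge : face_ideal I v `<=` wge (wt l) d.
Proof.
move=> f; apply; first exact: wge_ideal.
by move=> _ [a [Ia _] <-]; apply: Id.
Qed.

Lemma face_decomp p : exists q,
  ideal_gen [set 'X_j | j in [set j | j \notin Y]] (p - emb q).
Proof.
set L := ideal_gen _; have iL : is_ideal L by apply: ideal_genP.
have [L0 LD LM] := iL.
elim/mpoly_ring_ind: p => [c|j|p q [p' Lp] [q' Lq]|p q [p' Lp] [q' Lq]].
- by exists c%:MP; rewrite /face_emb comp_mpolyC subrr.
- have [jY|jY] := boolP (j \in Y); last first.
    by exists 0; rewrite /face_emb comp_mpoly0 subr0; apply: sub_ideal_gen; exists j.
  exists 'X_(enum_rank_in jY j); rewrite /face_emb comp_mpolyXU -tnth_nth tnth_mktuple.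
  by rewrite enum_rankK_in // subrr.
- by exists (p' + q'); rewrite /face_emb comp_mpolyD opprD addrACA; apply: LD.
exists (p' * q'); rewrite /face_emb comp_mpolyM.
have -> : p * q - (p' \mPo [tuple 'X_(enum_val j) | j < #|Y|]) *
    (q' \mPo [tuple 'X_(enum_val j) | j < #|Y|]) =
    q * (p - emb p') + emb p' * (q - emb q') by rewrite /face_emb; ring.
by apply: LD; apply: LM.
Qed.

Lemma mon_map_emb q :
  mon_map k alpha (emb q) = mon_map k (fun j : 'I_#|Y| => alpha (enum_val j)) q.
Proof.
elim/mpoly_ring_ind: q => [c|j|p q IHp IHq|p q IHp IHq].
- by rewrite /face_emb comp_mpolyC !mon_mapC.
- by rewrite /face_emb comp_mpolyXU -tnth_nth tnth_mktuple !mon_mapX.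
- by rewrite /face_emb comp_mpolyD !mon_mapD IHp IHq.
- by rewrite /face_emb comp_mpolyM !mon_mapM -/(emb p) -/(emb q) IHp IHq.
Qed.

Lemma mon_center_prime : prime_ideal [set p | fpart (mon_map k alpha p) = 0].
Proof. by apply: face_part_prime => p; apply: mon_map_halfspace alpha_wt. Qed.

Lemma center_off_face p :
  ideal_gen [set 'X_j | j in [set j | j \notin Y]] p ->
  fpart (mon_map k alpha p) = 0.
Proof.
have [iC _ _] := mon_center_prime.
move=> /(_ _ iC); apply=> _ [j jY <-]; rewrite /mkset mon_mapX.
apply/polyP => i; rewrite [RHS]coef0 coef_face_part coefMX coefC.
case: i => [|[|i]] /=; rewrite ?pihomog0 // muln1 pihomogX.
by case: eqP => // e; move: jY; rewrite /mkset face_varsP e eqxx.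
Qed.

Lemma on_face_enum (j : 'I_#|Y|) : wt l (alpha (enum_val j)) = d.
Proof. by have := enum_valP j; rewrite face_varsP => /eqP. Qed.

(** Modulo the variables off the face, a polynomial is one in the variables on
    the face, and such a polynomial lies in the center only if its image in
    R[t] is zero. *)
Lemma center_decomp p : fpart (mon_map k alpha p) = 0 ->
  exists q, mon_map k (fun j : 'I_#|Y| => alpha (enum_val j)) q = 0 /\
    ideal_gen [set 'X_j | j in [set j | j \notin Y]] (p - emb q).
Proof.
move=> p0; have [q pq] := face_decomp p; exists q; split=> //.
rewrite -[LHS](mon_map_on_face _ on_face_enum) -mon_map_emb -[RHS]p0.
by rewrite -[in RHS](subrK (emb q) p) mon_mapD face_partD (center_off_face pq) add0r.
Qed.

(** The image in R[t] of a polynomial in the variables of the face lies on the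
    boundary hyperplane, and so do its powers, whereas the elements of m R(I_i)
    lie strictly inside the half-space. Hence K_i is the kernel of the map to
    R[t]. *)
Lemma face_ker_extP p :
  face_ker_ext I alpha v p <-> fpart (mon_map k alpha p) = 0.
Proof.
have Fgen (j : 'I_#|Y|) : face_ideal I v 'X_[alpha (enum_val j)].
  apply: sub_ideal_gen; exists (alpha (enum_val j)) => //; split.
    exact: alpha_in.
  by rewrite v_wt on_face_enum vI.
have iE := ideal_genP (emb @` (@face_ker k n I r alpha v) `|`
             [set 'X_j | j in [set j | j \notin Y]]).
split.
  have [iC _ _] := mon_center_prime.
  move=> /(_ _ iC); apply=> _ [[q /fiber_kerP [N qN] <-]|[j jY <-]]; last first.
    by apply: center_off_face; apply: sub_ideal_gen; exists j.
  rewrite /mkset mon_map_emb.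
  have := mI_center face_ideal_wge qN.
  rewrite rees_valX rees_mapE // -mon_map_exp mon_map_on_face; last exact: on_face_enum.
  move/eqP; rewrite mon_map_exp expf_eq0 => /andP [_ /eqP ->].
  exact: face_part0.
move=> /center_decomp [q [q0 pq]]; rewrite -(subrK (emb q) p).
case: iE => _ ED EM; apply: ED.
  by apply: pq; [exact: ideal_genP | move=> x xY; apply: sub_ideal_gen; right].
apply: sub_ideal_gen; left; exists q => //; apply/fiber_kerP; exists 1%N.
rewrite expr1 (_ : rees_map _ _ q = 0).
  by case: (ideal_genP (rees_const (face_ideal I v) @` @maxideal k n)).
by apply: rees_val_inj; rewrite rees_mapE.
Qed.

End FaceOfIdeal.
End Face.

(** * Minimal primes of the fiber ring *)

Section FiberStructure.
Variables (k : fieldType) (n : nat).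
Local Notation R := {mpoly k[n]}.
Local Notation mI I := (ideal_gen (rees_const I @` @maxideal k n)).
Variables (I : set R) (r : nat) (alpha : 'I_r -> 'X_{1..n}).
Hypothesis I_monomial : monomial_ideal I.
Hypothesis gens : forall a, mingen I a <-> exists j, alpha j = a.
Hypothesis I_max : I `<=` @maxideal k n.

Lemma rees_coef_exp (F : rees I) b : ideal_exp I b F`_b.
Proof. by case: F => F /= /asboolP. Qed.

Lemma rees_homog_sum (F : rees I) :
  F = \sum_(b < size F) rees_elt I b F`_b.
Proof.
apply: rees_val_inj; rewrite rees_val_sum -[LHS]coefK poly_def.
apply: eq_bigr => b _; rewrite val_rees_elt ?mul_polyC //; exact: rees_coef_exp.
Qed.

(** The Rees ring is generated over R by I t, hence by the x^(alpha_j) t, and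
    modulo the maximal ideal its coefficients in R become constants. *)
Lemma fiber_gen z : exists p, z = fiber_proj I (rees_map alpha I p).
Proof.
pose good z := exists p, z = fiber_proj I (rees_map alpha I p).
have good0 : good 0 by exists 0; rewrite !rmorph0.
have goodD x y : good x -> good y -> good (x + y).
  by move=> [p ->] [q ->]; exists (p + q); rewrite !rmorphD.
have goodM x y : good x -> good y -> good (x * y).
  by move=> [p ->] [q ->]; exists (p * q); rewrite !rmorphM.
have good_const f : good (fiber_proj I (rees_const I f)).
  exists (f@_0%MM)%:MP; rewrite rees_mapC; apply/eqP; rewrite -subr_eq0 -rmorphB.
  apply/eqP/fiber_proj_eq0; apply: sub_ideal_gen; exists (f - (f@_0%MM)%:MP).
    by rewrite maxidealE /mkset mcoeffB mcoeffC eqxx mulr1 subrr.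
  by apply: rees_val_inj; rewrite /= polyCB.
have good_ideal b : is_ideal
    [set f | ideal_exp I b f /\ good (fiber_proj I (rees_elt I b f))].
  have [J0 JD JM] := ideal_expP I b; split.
  - split=> //; have -> : rees_elt I b 0 = 0; last by rewrite rmorph0.
    by apply: rees_val_inj; rewrite val_rees_elt // mul0r.
  - move=> f g [Jf gf] [Jg gg]; split; first exact: JD.
    by rewrite rees_eltD // rmorphD; apply: goodD.
  - move=> a f [Jf gf]; split; first exact: JM.
    by rewrite -(add0n b) rees_eltM // rees_elt0 rmorphM; apply: goodM.
have good1 f : I f -> good (fiber_proj I (rees_elt I 1 f)).
  move=> If; suff [] : [set f | ideal_exp I 1 f /\
      good (fiber_proj I (rees_elt I 1 f))] f by [].
  apply: (monomial_ideal_mingen I_monomial (good_ideal 1%N)) If.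
  move=> a ga; split; first exact: ideal_exp1 ga.1.
  by have /gens [j <-] := ga; exists 'X_j; rewrite rees_mapX.
have good_elt b f : ideal_exp I b f -> good (fiber_proj I (rees_elt I b f)).
  elim: b f => [|b IH] f Jf; first by rewrite rees_elt0.
  suff [] : [set f | ideal_exp I b.+1 f /\
      good (fiber_proj I (rees_elt I b.+1 f))] f by [].
  apply: Jf => // _ [u Iu [y Jy <-]]; rewrite -(add1n b); split.
    by apply: ideal_expD => //; apply: ideal_exp1.
  rewrite rees_eltM //; last exact: ideal_exp1.
  by rewrite rmorphM; apply: goodM; [apply: good1 | apply: IH].
have [F <-] := fiber_proj_surj z; rewrite [F]rees_homog_sum rmorph_sum.
by elim/big_rec: _ => // b x _ gx; apply: goodD => //; apply/good_elt/rees_coef_exp.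
Qed.

Section Nilpotence.
Variables (s : nat) (l : 'I_s -> 'I_n -> nat) (d : 'I_s -> nat).
Hypothesis Id : forall i, I `<=` wge (wt (l i)) (d i).
Hypothesis minimal : forall P, minimal_prime_over (@reesbar_ext _ I) P ->
  exists i, [set F : reesbar I | face_part (wt (l i)) (d i) F = 0] = P.

(** The condition on F is a condition on each of its terms f t^b separately, so
    it is enough to sum up the nilpotents given by rees_nilpotent. *)
Lemma fiber_nilpotent (F : rees I) :
  (forall i, face_part (wt (l i)) (d i) F = 0) ->
  exists N, fiber_proj I F ^+ N = 0.
Proof.
move=> F0; suff : fiber_proj I F \in @nilradical (fiber I) by move/asboolP.
rewrite [F]rees_homog_sum rmorph_sum; apply: rpred_sum => b _.
have Fb := rees_coef_exp F b.
have [|N FN] := @rees_nilpotent _ _ I s _ b F`_b I_max minimal Fb.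
  move=> i; apply/face_part_eq0 => [|c]; first exact: reesbar_halfspace.
  rewrite /= val_rees_elt // coefCM coefXn; case: eqP => [->|_].
    by rewrite mulr1; apply: (iffLR (face_part_eq0 (rees_halfspace (Id i) (F:=F)))).
  by rewrite mulr0; apply: wge0.
by apply/asboolP; exists N; rewrite -rmorphXn; apply/fiber_proj_eq0.
Qed.

End Nilpotence.

Section FiberPrime.
Variables (l : 'I_n -> nat) (d : nat) (v : {fraction {poly R}} -> int).
Hypothesis l_gt0 : forall i, (0 < l i)%N.
Hypothesis Id : I `<=` wge (wt l) d.
Hypothesis v_wt : forall a, val_of v ('X_[a] : R) = (wt l a)%:Z.
Hypothesis vI : ideal_value I v = d%:Z.
Local Notation fpart := (face_part (wt l) d).
Local Notation Y := (face_vars I alpha v).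

Lemma mon_mapX_center j : fpart (mon_map k alpha 'X_j) = 0 <-> j \notin Y.
Proof.
rewrite (face_varsP _ v_wt vI) mon_mapX; split=> [|jY].
  move/(congr1 (fun F : {poly R} => F`_1)); rewrite [RHS]coef0.
  rewrite coef_face_part coefMX coefC /= muln1 pihomogX.
  case: eqP => [e|//] /mpolyP/(_ (alpha j)); rewrite mcoeffX eqxx mcoeff0.
  by move/eqP; rewrite oner_eq0.
apply/polyP => i; rewrite [RHS]coef0 coef_face_part coefMX coefC.
by case: i => [|[|i]] /=; rewrite ?pihomog0 // muln1 pihomogX (negPf jY).
Qed.

Lemma center_class F G :
  fiber_proj I F = fiber_proj I G -> fpart F = 0 -> fpart G = 0.
Proof.
move=> e F0; rewrite -(subrK F G) rees_valD face_partD F0 addr0.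
by apply: (mI_center l_gt0 Id); apply/fiber_proj_eq0; rewrite rmorphB e subrr.
Qed.

(** A polynomial in Y representing the class of F splits by center_decomp into a
    part in the ideal of the variables off the face and a part that vanishes in
    R(I). *)
Lemma fiber_primeP F : fiber_prime I alpha v (fiber_proj I F) <-> fpart F = 0.
Proof.
have [[C0 CD CM] _ _] := rees_center_prime Id.
split.
  move=> LF; suff [G GF] : exists2 G, fiber_proj I G = fiber_proj I F & fpart G = 0.
    exact: center_class.
  apply: (LF [set z | exists2 G, fiber_proj I G = z & fpart G = 0]).
    split.
    - by exists 0; rewrite ?rmorph0.
    - by move=> _ _ [x <- x0] [y <- y0]; exists (x + y); rewrite ?rmorphD //; apply: CD.
    - move=> a _ [x <- x0]; have [y <-] := fiber_proj_surj a.
      by exists (y * x); rewrite ?rmorphM //; apply: CM.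
  move=> _ [j jY <-]; exists (rees_mon I (alpha j)) => //.
  rewrite val_rees_mon; last exact: (alpha_in gens).
  by rewrite -mon_mapX; apply/mon_mapX_center.
have [L0 LD LM] := ideal_genP [set fiber_mon I (alpha j) | j in [set j | j \notin Y]].
have [p e] := fiber_gen (fiber_proj I F) => F0; rewrite e.
have alpha_I := alpha_in gens.
have : fpart (mon_map k alpha p) = 0 by rewrite -(rees_mapE p alpha_I); apply: center_class F0.
move=> /(center_decomp gens Id v_wt vI) [q [q0 pq]].
have embq : rees_map alpha I (@face_emb k n I r alpha v q) = 0.
  by apply: rees_val_inj; rewrite rees_mapE // mon_map_emb.
have -> : rees_map alpha I p = rees_map alpha I (p - @face_emb k n I r alpha v q).
  by rewrite rmorphB embq subr0.
apply: (pq [set p | fiber_prime I alpha v (fiber_proj I (rees_map alpha I p))]).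
  split.
  - by rewrite /mkset !rmorph0.
  - by move=> x y Lx Ly; rewrite /mkset !rmorphD; apply: LD.
  - by move=> a x Lx; rewrite /mkset !rmorphM; apply: LM.
move=> _ [j jY <-]; rewrite /mkset rees_mapX.
by apply: sub_ideal_gen; exists j.
Qed.

Lemma fiber_prime_prime : prime_ideal (fiber_prime I alpha v).
Proof.
have [_ C1 CP] := rees_center_prime Id.
split; first exact: ideal_genP.
  by rewrite -(rmorph1 (fiber_proj I)) => /fiber_primeP.
move=> x y; have [F <-] := fiber_proj_surj x; have [G <-] := fiber_proj_surj y.
rewrite -rmorphM => /fiber_primeP /CP [] ?; [left | right]; exact/fiber_primeP.
Qed.

Lemma fiber_prime_mon j :
  fiber_prime I alpha v (fiber_mon I (alpha j)) <-> j \notin Y.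
Proof.
rewrite -mon_mapX_center mon_mapX -(val_rees_mon (alpha_in gens j)).
exact: fiber_primeP.
Qed.

End FiberPrime.
End FiberStructure.

Unset Implicit Arguments.

Theorem corollary6p12 (k : fieldType) (n : nat) (n_gt0 : (0 < n)%N)
    (I : set {mpoly k[n]})
    (I_monomial : monomial_ideal I) (I_dim0 : zero_dimensional I)
    (s : nat) (v : 'I_s -> {fraction {poly {mpoly k[n]}}} -> int)
    (v_Rees : rees_valuations I v)
    (r : nat) (alpha : 'I_r -> 'X_{1..n}) (alpha_inj : injective alpha)
    (alpha_gens : forall a, mingen I a <-> exists j, alpha j = a) :
  (* (a) *)
  ((forall P : set (fiber I),
      minimal_prime P <-> exists i, fiber_prime I alpha (v i) = P) /\
   injective (fun i => fiber_prime I alpha (v i))) /\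
  (* (b) *)
  [/\ fiber_ker I alpha =
        [set p | forall i, face_ker_ext I alpha (v i) p],
      forall i, prime_ideal (face_ker_ext I alpha (v i)) &
      forall i, fiber_ker I alpha <>
        [set p | forall j, j != i -> face_ker_ext I alpha (v j) p]].
Proof.
have I_max := monomial_ideal_sub_max I_monomial (zero_dimensional_proper I_dim0).
have [Q [Q_inj Q_min Q_val]] := v_Rees.
have Qmin i : minimal_prime_over (@reesbar_ext _ I) (Q i) by apply/Q_min; exists i.
have /choice [l /choice [d ld]] i := rees_valuation_monomial n_gt0 I_monomial
  I_dim0 (Q_val i).1 (Q_val i).2 (Qmin i).
have l_gt0 i := let: And5 h _ _ _ _ := ld i in h.
have Id i := let: And5 _ h _ _ _ := ld i in h.
have Ine i := let: And5 _ _ h _ _ := ld i in h.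
have QE i := let: And5 _ _ _ h _ := ld i in h.
have v_wt i : forall a, _ := let: And5 _ _ _ _ h := ld i in h.1.
have vI i := let: And5 _ _ _ _ h := ld i in h.2.
pose Y i := face_vars I alpha (v i).
have YP i j : j \in Y i = (wt (l i) (alpha j) == d i) by apply: face_varsP.
(* Q i' lies in Q i as soon as the face i lies in the face i', so the
   minimality of Q i forbids any inclusion between two faces. *)
have sep i i' : i' != i -> exists2 j, j \in Y i & j \notin Y i'.
  move=> ii; apply: contrapT => noj; move/eqP: ii; apply; apply: Q_inj.
  case: (Qmin i) => _ _; apply; try by case: (Qmin i').
  rewrite !QE; apply: (center_sub I_monomial alpha_gens) => // j /eqP.
  rewrite -YP => jY; apply/eqP; rewrite -YP; apply/negPn/negP => jY'.
  by apply: noj; exists j.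
pose C i : set {mpoly k[r]} := [set p | face_part (wt (l i)) (d i) (mon_map k alpha p) = 0].
have CE i : face_ker_ext I alpha (v i) = C i.
  by apply/seteqP; split=> p /(face_ker_extP (l_gt0 i) alpha_gens (Id i) (v_wt i) (vI i)).
have C_prime i : prime_ideal (C i) := mon_center_prime alpha_gens (Id i).
have CX i j : C i 'X_j <-> j \notin Y i := mon_mapX_center _ (v_wt i) (vI i) j.
have alpha_I := alpha_in alpha_gens.
have nil p : (forall i, C i p) -> exists N, fiber_proj I (rees_map alpha I p) ^+ N = 0.
  move=> Cp; apply: (fiber_nilpotent I_max Id) => [P /Q_min [i <-]|i].
    by exists i; rewrite QE.
  by rewrite (rees_mapE p alpha_I); apply: Cp.
have L_prime i : prime_ideal (fiber_prime I alpha (v i)).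
  exact: (fiber_prime_prime I_monomial alpha_gens (l_gt0 i) (Id i) (v_wt i) (vI i)).
have L_mon i j : fiber_prime I alpha (v i) (fiber_mon I (alpha j)) <-> j \notin Y i.
  exact: (fiber_prime_mon I_monomial alpha_gens (l_gt0 i) (Id i) (v_wt i) (vI i)).
have L_sub i i' : fiber_prime I alpha (v i') `<=` fiber_prime I alpha (v i) -> i' = i.
  move=> LL; apply: contrapT => /eqP /sep [j jY jY'].
  by have /LL /L_mon : fiber_prime I alpha (v i') (fiber_mon I (alpha j));
    [apply/L_mon | rewrite jY].
(* otherwise the product of one variable off each face would lie outside of P,
   although it is nilpotent *)
have L_below P : prime_ideal P -> exists i, fiber_prime I alpha (v i) `<=` P.
  move=> pP; apply: contrapT => /forallNP noL.
  have /choice [j jP] i : exists j, j \notin Y i /\ ~ P (fiber_mon I (alpha j)).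
    apply: contrapT => /forallNP noj; apply: (noL i) => z; apply; first by case: pP.
    by move=> _ [j jY <-]; apply: contrapT => nP; apply: (noj j).
  have nP := prime_prod (r := index_enum 'I_s) pP (fun i => (jP i).2).
  have [|N zN] := nil (\prod_i 'X_(j i)).
    move=> i; rewrite (bigD1 i) //= mulrC; have [[_ _ CM] _ _] := C_prime i.
    by apply: CM; apply/CX; case: (jP i).
  apply: nP; apply: (prime_expr (m := N) pP).
  have <- : fiber_proj I (rees_map alpha I (\prod_i 'X_(j i))) =
      \prod_i fiber_mon I (alpha (j i)).
    by rewrite !rmorph_prod; apply: eq_bigr => i _; rewrite rees_mapX.
  by rewrite zN; case: pP => -[].
have kerE p : fiber_ker I alpha p <-> forall i, C i p.
  rewrite fiber_kerP; split=> [[N pN] i|/nil [N pN]]; last first.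
    by exists N; apply/fiber_proj_eq0; rewrite rmorphXn.
  apply: (prime_expr (m := N) (C_prime i)); rewrite /C /mkset mon_map_exp.
  by rewrite -(rees_mapE p alpha_I) -rees_valX; apply: (mI_center (l_gt0 i) (Id i)).
split; [split|split].
- move=> P; split=> [[pP _ Pmin]|[i <-]].
    have [i LP] := L_below P pP; exists i; apply: Pmin => // z ->.
    by case: (L_prime i) => -[].
  split=> // [z ->|P' pP' _ P'L]; first by case: (L_prime i) => -[].
  have [i' LP'] := L_below P' pP'; apply/seteqP; split=> //.
  by have <- : i' = i by apply: L_sub; apply: subset_trans P'L.
- by move=> i' i /= e; apply: L_sub; rewrite e.
- apply/seteqP; split=> p; first by move=> /kerE Cp i; rewrite CE.
  by move=> Cp; apply/kerE => i; rewrite -CE; apply: Cp.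
- by move=> i; rewrite CE.
move=> i e.
(* the product over j <> i of a variable on the face i and off the face j lies in
   every component except the one of i *)
have /choice [x xP] j : exists x, ~ C i x /\ (j != i -> C j x).
  have [->|ji] := eqVneq j i; first by exists 1; split=> //; case: (C_prime i).
  have [a aY aY'] := sep i j ji; exists 'X_a; split; first by rewrite CX aY.
  by move=> _; apply/CX.
have nC := prime_prod (r := index_enum 'I_s) (C_prime i) (fun j => (xP j).1).
apply: nC; apply: (iffLR (kerE _)); rewrite e => j ji; rewrite CE (bigD1 j) //= mulrC.
by have [[_ _ CM] _ _] := C_prime j; apply: CM; apply: (xP j).2.
Qed.
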